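(* Let $\nu$ be the measure of maximal entropy of the Bowen-Series map $A_{G_2}:\mathbb{S}^1\to\mathbb{S}^1$. Then $\mathrm{HD}(\nu)<1$.
   Context: Let $C_1$ and $C_2$ be the hyperbolic geodesics of the unit disk $\mathbb{D}$ with endpoints $1,i$ and $i,-1$, respectively. For $j=1,2$ let $g_j$ be the Möbius automorphism of $\mathbb{D}$ given by (anti-Möbius) reflection in $C_j$ followed by complex conjugation, and $G_2=\langle g_1,g_2\rangle$, a Fuchsian group uniformizing a thrice punctured sphere. Let $I_1,I_2\subset\mathbb{S}^1$ be the closed counter-clockwise arcs from $1$ to $i$ and from $i$ to $-1$, and let $I_{-j}$ be the complex conjugate of $I_j$. The Bowen-Series map $A_{G_2}$ of $G_2$ is defined by $A_{G_2}|_{I_{\pm j}}=g_j^{\pm1}$, $j=1,2$. It is a covering map topologically conjugate to $z\mapsto z^3$ on $\mathbb{S}^1$; its measure of maximal entropy is the unique $A_{G_2}$-invariant Borel probability measure $\nu$ whose entropy equals the topological entropy $\ln 3$. The Hausdorff dimension of $\nu$ is $\mathrm{HD}(\nu)=\inf\{\mathrm{HD}(Y):Y\subset\mathbb{S}^1,\ \nu(Y)=1\}$, where $\mathrm{HD}(Y)$ is the Hausdorff dimension of $Y$. *)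

(* Defs.v *)
From HB Require Import structures.
From mathcomp Require Import all_boot all_order all_algebra.
From mathcomp Require Import all_classical all_reals all_analysis.
From mathcomp Require Import ring lra.

Set Implicit Arguments.
Unset Strict Implicit.
Unset Printing Implicit Defensive.

Import Order.TTheory GRing.Theory Num.Theory.
Import numFieldNormedType.Exports.
(* Imported after Num.Theory, so that Re and Im are the R-valued projections of
   R[i]. *)
From mathcomp Require Import complex.

Local Open Scope classical_set_scope.
Local Open Scope ring_scope.
Local Open Scope complex_scope.

Section HausdorffDimension.
Context {R : realType} {T : metricType R}.
Local Open Scope ereal_scope.

(* The maximum with 0 gives the empty set diameter 0, instead of -oo. *)
Definition diam (U : set T) : \bar R :=
  maxe 0 (ereal_sup [set (mdist xy.1 xy.2)%:E | xy in U `*` U]).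

Definition hausdorff_premeasure (s delta : R) (Y : set T) : \bar R :=
  ereal_inf [set \sum_(0 <= k <oo) (diam (U k)) `^ s | U in
    [set U : nat -> set T |
      Y `<=` \bigcup_k U k /\ forall k, diam (U k) <= delta%:E]].

Definition hausdorff_measure (s : R) (Y : set T) : \bar R :=
  ereal_sup [set hausdorff_premeasure s delta Y | delta in [set d | 0 < d]%R].

(* Only exponents s > 0 are used: for s = 0 the convention 0 `^ 0 = 1 would
   count the empty sets of a cover, and s = 0 does not affect the infimum. *)
Definition hausdorff_dim (Y : set T) : \bar R :=
  ereal_inf [set s%:E | s in [set s | (0 < s)%R /\ hausdorff_measure s Y = 0]].

End HausdorffDimension.

Section TopologicalEntropy.
Context {R : realType} {T : metricType R}.
Variable f : T -> T.

(* s lists, without repetition, an (n, eps)-separated subset of T. *)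
Definition orbit_separated (n : nat) (eps : R) (s : seq T) : Prop :=
  uniq s /\ forall x y, x \in s -> y \in s -> x != y ->
    exists2 i, (i < n)%N & eps < mdist (iter i f x) (iter i f y).

(* Bowen's definition; the supremum over eps is the limit as eps -> 0. *)
Definition topological_entropy : \bar R :=
  ereal_sup [set limn_esup (fun n => ereal_sup
      [set (ln (size s)%:R / n%:R)%:E | s in orbit_separated n eps])
    | eps in [set e : R | 0 < e]].

End TopologicalEntropy.

Section KolmogorovSinaiEntropy.
Context {R : realType} {d : measure_display} {T : measurableType d}.
Variables (mu : probability T R) (f : T -> T).

(* A finite partition with k labelled (possibly empty) cells is encoded by its
   labelling function xi : T -> 'I_k. *)
Definition measurable_partition k (xi : T -> 'I_k) : Prop :=
  forall i, measurable (xi @^-1` [set i]).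

(* The cells of the join of xi, xi \o f, ..., xi \o f^(n-1). *)
Definition cell k (xi : T -> 'I_k) n (w : {ffun 'I_n -> 'I_k}) : set T :=
  [set x | forall i : 'I_n, xi (iter i f x) = w i].

Definition join_entropy k (xi : T -> 'I_k) (n : nat) : R :=
  \sum_(w : {ffun 'I_n -> 'I_k})
    - (fine (mu (cell xi w)) * ln (fine (mu (cell xi w)))).

(* For invariant mu, the upper limit is a limit by subadditivity. *)
Definition partition_entropy k (xi : T -> 'I_k) : \bar R :=
  limn_esup (fun n => (join_entropy xi n / n%:R)%:E).

Definition measure_entropy : \bar R :=
  ereal_sup [set h | exists k (xi : T -> 'I_k),
    measurable_partition xi /\ h = partition_entropy xi].

Definition invariant_measure : Prop :=
  forall B, measurable B -> mu (f @^-1` B) = mu B.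

End KolmogorovSinaiEntropy.

Section Circle.
Variable R : realType.

Definition circle : Type := {z : R[i] | `|z| == 1}.

HB.instance Definition _ := SubChoice.on circle.

Lemma norm_circle (z : circle) : `|val z| = 1 :> R[i].
Proof. by apply/eqP; exact: (valP z). Qed.

Lemma circle1_subproof : `|1 : R[i]| == 1.
Proof. by rewrite normr1. Qed.

HB.instance Definition _ :=
  isPointed.Build circle (exist _ (1 : R[i]) circle1_subproof).

Definition chord (x y : circle) : R := Normc.normc (val x - val y).

Lemma chordxx x : chord x x = 0.
Proof. by rewrite /chord subrr Normc.normc0. Qed.

Lemma chord_positivity x y : chord x y = 0 -> x = y.
Proof. by move/Normc.eq0_normc/eqP; rewrite subr_eq0 => /eqP/val_inj. Qed.

Lemma chord_sym x y : chord x y = chord y x.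
Proof. by rewrite /chord -opprB (@normcN R (val y - val x)). Qed.

Lemma chord_triangle y x z : chord x z <= chord x y + chord y z.
Proof.
rewrite /chord -(subrKA (val y) (val x)).
exact: (@le_normcD R (val x - val y)).
Qed.

HB.instance Definition _ := isMetric.Build R circle
  chordxx chord_positivity chord_sym chord_triangle.

HB.instance Definition _ :=
  Measurable.copy circle (g_sigma_algebraType (@open circle)).

(* The inversion in the circle of center c and radius r. *)
Definition reflection (c : R[i]) (r : R) (z : R[i]) : R[i] :=
  c + r%:C ^+ 2 / conjc (z - c).

(* The geodesic of the unit disk with endpoints a and b is the part in the disk
   of the circle through a and b orthogonal to the unit circle. *)
Definition geodesic_circle (a b c : R[i]) (r : R) : Prop :=
  [/\ `|c| ^+ 2 = 1 + r%:C ^+ 2, `|a - c| = r%:C & `|b - c| = r%:C].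

Definition center1 : R[i] := 1 +i* 1.
Definition center2 : R[i] := (- 1) +i* 1.

Lemma normcC (a b : R) : `|a +i* b| ^+ 2 = (a ^+ 2 + b ^+ 2)%:C.
Proof. by rewrite -add_Re2_Im2. Qed.

Lemma circle_sqr (z : R[i]) : `|z| = 1 -> Re z ^+ 2 + Im z ^+ 2 = 1.
Proof.
by move=> z1; apply: (@complexI R); rewrite /= add_Re2_Im2 z1 expr1n.
Qed.

Lemma normi : `|'i : R[i]| = 1.
Proof. by rewrite normc_def /= expr0n expr1n add0r sqrtr1. Qed.

Lemma sqr_norm_center1 : `|center1| ^+ 2 = 1 + (1 : R)%:C ^+ 2.
Proof. by rewrite normcC expr1n rmorphD /= expr1n. Qed.

Lemma sqr_norm_center2 : `|center2| ^+ 2 = 1 + (1 : R)%:C ^+ 2.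
Proof. by rewrite normcC sqrrN expr1n rmorphD /= expr1n. Qed.

Lemma geodesic_C1 : geodesic_circle 1 'i%C center1 1.
Proof.
split; first exact: sqr_norm_center1.
- have -> : 1 - center1 = - 'i
    by apply/eqP; rewrite eq_complex /=; apply/andP; split; apply/eqP; ring.
  by rewrite normrN normi.
- have -> : 'i - center1 = - 1
    by apply/eqP; rewrite eq_complex /=; apply/andP; split; apply/eqP; ring.
  by rewrite normrN normr1.
Qed.

Lemma geodesic_C2 : geodesic_circle 'i%C (- 1) center2 1.
Proof.
split; first exact: sqr_norm_center2.
- have -> : 'i - center2 = 1
    by apply/eqP; rewrite eq_complex /=; apply/andP; split; apply/eqP; ring.
  by rewrite normr1.
- have -> : - 1 - center2 = - 'i.
    by apply/eqP; rewrite eq_complex /=; apply/andP; split; apply/eqP; ring.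
  by rewrite normrN normi.
Qed.

Lemma reflection_norm (c : R[i]) (r : R) (z : R[i]) : r != 0 ->
  `|c| ^+ 2 = 1 + r%:C ^+ 2 -> `|z| = 1 -> `|reflection c r z| = 1.
Proof.
move=> r0 cr z1.
have zc : z - c != 0.
  rewrite subr_eq0; apply: contra_neq r0 => zc.
  move: cr; rewrite -zc z1 expr1n -{1}[1]addr0 => /addrI /esym/eqP.
  by rewrite expf_eq0 /= => /eqP/(@complexI R).
have zc' : conjc (z - c) != 0 by rewrite conjc_eq0.
have -> : reflection c r z = (c - z) * conjc z / conjc (z - c).
  apply: (mulIf zc'); rewrite divfK // /reflection mulrDl divfK //.
  rewrite rmorphB mulrBr mulrBl -!sqr_normc z1 cr expr1n; ring.
by rewrite normrM normfV normrM !normcJ z1 mulr1 distrC divff // normr_eq0.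
Qed.

Lemma reflectionK (c : R[i]) (r : R) (z : R[i]) : r != 0 -> z != c ->
  reflection c r (reflection c r z) = z.
Proof.
move=> r0; rewrite -subr_eq0 => zc.
have zc' : conjc (z - c) != 0 by rewrite conjc_eq0.
have r0' : r%:C != 0 :> R[i].
  by apply: contra_neq r0; exact: (@complexI R).
have e : reflection c r z - c = r%:C ^+ 2 / conjc (z - c).
  by rewrite /reflection addrAC subrr add0r.
transitivity (c + r%:C ^+ 2 / (r%:C ^+ 2 / (z - c))).
  congr (_ + _ / _); rewrite e (rmorphM (@conjc R)) fmorphV (rmorphXn (@conjc R)).
  by congr (_ ^+ 2 / _); [exact: conjc_real|exact: conjcK].
by rewrite invf_div mulrCA divff ?expf_neq0// mulr1 addrC subrK.
Qed.

Lemma reflection_fix (c : R[i]) (r : R) (z : R[i]) : r != 0 ->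
  `|z - c| = r%:C -> reflection c r z = z.
Proof.
move=> r0 zcr; rewrite /reflection -zcr sqr_normc mulfK ?subrKC//.
rewrite conjc_eq0 -normr_eq0 zcr.
by apply: contra_neq r0; exact: (@complexI R).
Qed.

(* g_j is the inversion in the circle carrying C_j followed by conjugation, and
   gjV is its inverse. *)
Definition g1 (z : R[i]) : R[i] := conjc (reflection center1 1 z).
Definition g2 (z : R[i]) : R[i] := conjc (reflection center2 1 z).
Definition g1V (z : R[i]) : R[i] := reflection center1 1 (conjc z).
Definition g2V (z : R[i]) : R[i] := reflection center2 1 (conjc z).

Lemma g1K (z : R[i]) : z != center1 -> g1V (g1 z) = z.
Proof. by move=> zc; rewrite /g1V /g1 conjcK reflectionK ?oner_neq0. Qed.

Lemma g1VK (z : R[i]) : conjc z != center1 -> g1 (g1V z) = z.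
Proof. by move=> zc; rewrite /g1V /g1 reflectionK ?oner_neq0 ?conjcK. Qed.

Lemma g2K (z : R[i]) : z != center2 -> g2V (g2 z) = z.
Proof. by move=> zc; rewrite /g2V /g2 conjcK reflectionK ?oner_neq0. Qed.

Lemma g2VK (z : R[i]) : conjc z != center2 -> g2 (g2V z) = z.
Proof. by move=> zc; rewrite /g2V /g2 reflectionK ?oner_neq0 ?conjcK. Qed.

Definition arc1 : set R[i] := [set z | [/\ `|z| = 1, 0 <= Re z & 0 <= Im z]].
Definition arc2 : set R[i] := [set z | [/\ `|z| = 1, Re z <= 0 & 0 <= Im z]].
Definition arc1V : set R[i] := [set conjc z | z in arc1].
Definition arc2V : set R[i] := [set conjc z | z in arc2].

(* arc1 and arc2 are the closed counter-clockwise arcs from 1 to i and from i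
   to -1; arc1V and arc2V are their conjugates, where the map is
   the inverse of g_j.
   The arcs cover the circle, so the last branch is the arc arc2V; at the
   common endpoints of two arcs the branches agree (see bowen_seriesE). *)
Definition bowen_series_fun (z : R[i]) : R[i] :=
  if z \in arc1 then g1 z
  else if z \in arc2 then g2 z
  else if z \in arc1V then g1V z
  else g2V z.

Lemma bowen_series_fun_norm (z : R[i]) : `|z| = 1 -> `|bowen_series_fun z| == 1.
Proof.
move=> z1; rewrite /bowen_series_fun /g1 /g2 /g1V /g2V.
have o0 := oner_neq0 R.
by case: ifP => _; [|case: ifP => _; [|case: ifP => _]];
  rewrite ?normcJ reflection_norm ?normcJ ?sqr_norm_center1 ?sqr_norm_center2.
Qed.

Definition bowen_series (z : circle) : circle :=
  exist _ (bowen_series_fun (val z)) (bowen_series_fun_norm (norm_circle z)).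

Lemma arc1VE (z : R[i]) : arc1V z <-> [/\ `|z| = 1, 0 <= Re z & Im z <= 0].
Proof.
split=> [[w [w1 rw iw] <-]|[z1 rz iz]].
  by rewrite normcJ; case: w w1 rw iw => a b /= -> ? ?; rewrite oppr_le0.
exists (conjc z); last exact: conjcK.
by split; rewrite ?normcJ//; case: z rz iz {z1} => a b //=; rewrite oppr_ge0.
Qed.

Lemma arc2VE (z : R[i]) : arc2V z <-> [/\ `|z| = 1, Re z <= 0 & Im z <= 0].
Proof.
split=> [[w [w1 rw iw] <-]|[z1 rz iz]].
  by rewrite normcJ; case: w w1 rw iw => a b /= -> ? ?; rewrite oppr_le0.
exists (conjc z); last exact: conjcK.
by split; rewrite ?normcJ//; case: z rz iz {z1} => a b //=; rewrite oppr_ge0.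
Qed.

Lemma circle_arcs (z : circle) :
  [\/ arc1 (val z), arc2 (val z), arc1V (val z) | arc2V (val z)].
Proof.
have z1 := norm_circle z.
have [rz|/ltW rz] := leP 0 (Re (val z)); have [iz|/ltW iz] := leP 0 (Im (val z)).
- by constructor 1.
- by constructor 3; apply/arc1VE.
- by constructor 2.
- by constructor 4; apply/arc2VE.
Qed.


Lemma arc12 (z : R[i]) : arc1 z -> arc2 z -> z = 'i.
Proof.
case: z => x y [/circle_sqr /= z1 x0 y0] [_ /= x0' _].
have {x0'}x0 : x = 0 by apply: le_anti; rewrite x0 x0'.
by rewrite x0 in z1 *; congr (_ +i* _); nra.
Qed.

Lemma arc1V2V (z : R[i]) : arc1V z -> arc2V z -> z = conjc 'i.
Proof.
case: z => x y /arc1VE[/circle_sqr /= z1 x0 y0] /arc2VE[_ /= x0' _].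
have {x0'}x0 : x = 0 by apply: le_anti; rewrite x0 x0'.
by rewrite x0 in z1 *; congr (_ +i* _); nra.
Qed.

Lemma arc11V (z : R[i]) : arc1 z -> arc1V z -> z = 1.
Proof.
case: z => x y [/circle_sqr /= z1 x0 y0] /arc1VE[_ /= _ y0'].
have {y0'}y0 : y = 0 by apply: le_anti; rewrite y0 y0'.
by rewrite y0 in z1 *; congr (_ +i* _); nra.
Qed.

Lemma arc22V (z : R[i]) : arc2 z -> arc2V z -> z = - 1.
Proof.
case: z => x y [/circle_sqr /= z1 x0 y0] /arc2VE[_ /= _ y0'].
have {y0'}y0 : y = 0 by apply: le_anti; rewrite y0 y0'.
rewrite y0 in z1 *; apply/eqP; rewrite eq_complex /= oppr0 eqxx andbT.
by apply/eqP; nra.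
Qed.

Lemma arc12V (z : R[i]) : arc1 z -> arc2V z -> False.
Proof.
case: z => x y [/circle_sqr /= z1 x0 y0] /arc2VE[_ /= x0' y0'].
have x00 : x = 0 by apply: le_anti; rewrite x0 x0'.
have y00 : y = 0 by apply: le_anti; rewrite y0 y0'.
by move: z1; rewrite x00 y00; lra.
Qed.

Lemma arc21V (z : R[i]) : arc2 z -> arc1V z -> False.
Proof.
case: z => x y [/circle_sqr /= z1 x0 y0] /arc1VE[_ /= x0' y0'].
have x00 : x = 0 by apply: le_anti; rewrite x0 x0'.
have y00 : y = 0 by apply: le_anti; rewrite y0 y0'.
by move: z1; rewrite x00 y00; lra.
Qed.

Lemma g_endpoints :
  [/\ g1 1 = 1, g1V 1 = 1, g1 'i = conjc 'i & g1V (conjc 'i) = 'i] /\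
  [/\ g2 (- 1) = - 1, g2V (- 1) = - 1, g2 'i = conjc 'i & g2V (conjc 'i) = 'i].
Proof.
have [_ e1 ei] := geodesic_C1; have [_ fi f1] := geodesic_C2.
have o0 := oner_neq0 R; have c1 := rmorph1 (@conjc R).
rewrite /g1 /g1V /g2 /g2V !conjcK rmorphN c1.
by rewrite !reflection_fix // ?rmorphN ?c1.
Qed.

Lemma bowen_seriesE (z : circle) :
  [/\ arc1 (val z) -> val (bowen_series z) = g1 (val z),
      arc2 (val z) -> val (bowen_series z) = g2 (val z),
      arc1V (val z) -> val (bowen_series z) = g1V (val z) &
      arc2V (val z) -> val (bowen_series z) = g2V (val z)].
Proof.
have [[a1 a2 a3 a4] [b1 b2 b3 b4]] := g_endpoints.
rewrite /= /bowen_series_fun; split => az.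
- by rewrite mem_set.
- case: ifPn => [/set_mem az'|_]; first by rewrite (arc12 az' az) a3 b3.
  by rewrite mem_set.
- case: ifPn => [/set_mem az'|_]; first by rewrite (arc11V az' az) a1 a2.
  case: ifPn => [/set_mem az'|_]; first by case: (arc21V az' az).
  by rewrite mem_set.
- case: ifPn => [/set_mem az'|_]; first by case: (arc12V az' az).
  case: ifPn => [/set_mem az'|_]; first by rewrite (arc22V az' az) b1 b2.
  case: ifPn => [/set_mem az'|_] //.
  by rewrite (arc1V2V az' az) a4 b4.
Qed.

Definition maximal_entropy (nu : probability circle R) (f : circle -> circle) :
    Prop :=
  invariant_measure nu f /\ measure_entropy nu f = topological_entropy f.

Definition measure_dim (nu : probability circle R) : \bar R :=
  ereal_inf [set hausdorff_dim Y | Y in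
    [set Y : set circle | measurable Y /\ nu Y = 1%E]].

End Circle.

(* Main.v *)
Require Import Defs.
From mathcomp Require Import all_boot all_order all_algebra.
From mathcomp Require Import all_classical all_reals all_analysis.
From mathcomp Require Import ring lra.

(* In the coordinate t with z = (1 + i t)^2 / (1 + t^2) the branches of the map
   act through SL_2(Z), so the points with a given itinerary of length n form an
   arc between two integer vectors, of length comparable to 1 / D, where D is the
   product of the l1 norms of these vectors.  Subdividing an arc with norms
   (a, b) gives three arcs, with norms (a, 2a + b), (a + b, 2a + b) and
   (a + b, b).  Since these are never equally long, the sum of D^(-1/2) over all
   words of length n is O((12/7)^n) with 12/7 < sqrt 3, so there are exponentially
   fewer than 3^n words with D < 3^n.  If these bad words had mass bounded below
   at all large levels, the entropy of the partition into quadrants would be less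
   than ln 3; as this partition is a generator, so would the entropy of the
   measure, although the topological entropy is at least ln 3 (the 3^n preimages
   of a point under the n-th iterate are separated).  Hence almost every point
   lies in good arcs for infinitely many n, and the good arcs of length at least
   n cover these points with s-dimensional sums tending to 0 for some s < 1. *)

Set Implicit Arguments.
Unset Strict Implicit.
Unset Printing Implicit Defensive.

Import Order.TTheory GRing.Theory Num.Theory.
Import numFieldNormedType.Exports.
(* Imported last, so that Re and Im are the R-valued projections of R[i]. *)
From mathcomp Require Import complex.

Local Open Scope classical_set_scope.
Local Open Scope ring_scope.

(** * Itineraries and the subdivision of arcs *)

(* A quadrant of the circle, given by whether the real and imaginary parts are
   on the positive side. *)
Definition label := (bool * bool)%type.

(* The image of a quadrant is the complement of the conjugate quadrant. *)
Definition allowed : rel label :=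
  fun l l' => ~~ ((l.1 == l'.1) && (l.2 != l'.2)).

Lemma big_tuple_cons (V : nmodType) (T : finType) n (F : n.+1.-tuple T -> V)
    (P : pred (n.+1.-tuple T)) :
  \sum_(w | P w) F w =
  \sum_(a : T) \sum_(s : n.-tuple T | P (cons_tuple a s)) F (cons_tuple a s).
Proof.
rewrite (reindex (fun p : T * n.-tuple T => cons_tuple p.1 p.2)) /=; last first.
  exists (fun w => (thead w, behead_tuple w)) => [[a s] _ /=|w _].
    by congr pair; apply: val_inj.
  by apply: val_inj; rewrite /= [in RHS](tuple_eta w).
by rewrite pair_big_dep.
Qed.

Section WordTree.
Variable R : realType.
Implicit Types (l : label) (u : R * R) (s : seq label).

(* u holds the l1 norms of the integer vectors spanning the endpoints of an arc,
   the image of 1 or -1 (respectively i or -i) coming first. *)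
Definition child l l' u : R * R :=
  if l.1 == l'.1 then (u.1, 2 * u.1 + u.2)
  else if l.2 == l'.2 then (u.1 + u.2, 2 * u.1 + u.2)
  else (u.1 + u.2, u.2).

Fixpoint weights l u s : R * R :=
  if s is l' :: s' then weights l' (child l l' u) s' else u.

Definition denom u := u.1 * u.2.

Lemma child_ge1 l l' u : 1 <= u.1 -> 1 <= u.2 ->
  [/\ 1 <= (child l l' u).1, 1 <= (child l l' u).2 &
    denom u + 1 <= denom (child l l' u)].
Proof.
case: u => a b /= a1 b1; rewrite /child /denom.
by case: eqP => _ /=; last (case: eqP => _ /=); split; nra.
Qed.

(** Each subdivision adds at least 1 to the product, which shrinks all arcs to points uniformly.
    Growth can be merely linear: along the itinerary of the parabolic point 1 the first norm never
    changes. *)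
Lemma weights_ge1 l u s : 1 <= u.1 -> 1 <= u.2 ->
  [/\ 1 <= (weights l u s).1, 1 <= (weights l u s).2 &
    denom u + (size s)%:R <= denom (weights l u s)].
Proof.
elim: s l u => [|l' s IH] l u u1 u2 /=; first by rewrite addr0.
have [c1 c2 c3] := child_ge1 l l' u1 u2.
have [d1 d2 d3] := IH l' _ c1 c2.
by split => //; apply: le_trans d3; rewrite -natr1; lra.
Qed.

Lemma sum_allowed l (F : label -> R) :
  \sum_(l' | allowed l l') F l' =
  F l + F (~~ l.1, l.2) + F (~~ l.1, ~~ l.2).
Proof.
rewrite big_mkcond.
transitivity (\sum_(p : bool * bool)
    (fun a b => if allowed l (a, b) then F (a, b) else 0) p.1 p.2).
  by apply: eq_bigr => -[].
rewrite -(pair_bigA _ (fun a b => if allowed l (a, b) then F (a, b) else 0)) /=.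
by rewrite !big_bool /=; case: l => [[] []] /=; rewrite /allowed /=; ring.
Qed.

(** The hypothesis is the one-step inequality over the three children of an arc; it iterates down
    the tree of admissible words. It is applied to [invsqrt] with c = 12/7 and to a constant with c
    = 3. *)
Lemma sum_words (P : R * R -> R) (c : R) : 0 <= c ->
  (forall a b, 1 <= a -> 1 <= b ->
    P (a, 2 * a + b) + P (a + b, 2 * a + b) + P (a + b, b) <= c * P (a, b)) ->
  forall n l u, 1 <= u.1 -> 1 <= u.2 ->
  \sum_(s : n.-tuple label | path allowed l s) P (weights l u s)
    <= c ^+ n * P u.
Proof.
move=> c0 Pc; elim=> [|n IH] l u u1 u2.
  rewrite (big_pred1 [tuple]) /= ?expr0 ?mul1r// => s.
  by rewrite tuple0 /=; apply/esym/eqP.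
rewrite big_tuple_cons /= (bigID (allowed l)) /= [X in _ + X]big1 ?addr0; last first.
  by move=> l' /negPf l'0; rewrite big_pred0 // => s; rewrite l'0.
apply: (@le_trans _ _ (\sum_(l' | allowed l l') c ^+ n * P (child l l' u))).
  apply: ler_sum => l' ll'; have [c1 c2 _] := child_ge1 l l' u1 u2.
  apply: le_trans (IH l' _ c1 c2); rewrite ll'.
  exact: lexx.
rewrite -mulr_sumr exprSr -mulrA ler_wpM2l ?exprn_ge0// sum_allowed.
case: u u1 u2 => a b /= a1 b1; rewrite /child /= !eqxx.
by case: l => [[] []] /=; exact: Pc.
Qed.

(** The right-hand side is the tangent to the concave square root at [m ^+ 2]. *)
Lemma sqrt_tangent (p m : R) : 0 <= p -> 0 < m -> Num.sqrt p <= (p / m + m) / 2.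
Proof.
move=> p0 m0; have := sqr_ge0 (Num.sqrt p - m).
rewrite sqrrB sqr_sqrtr// => h.
rewrite ler_pdivlMr// -(ler_pM2r m0) mulrDl divfK ?gt_eqF//; nra.
Qed.

(* The three children carry fractions p1, p2, p3 of the mass 1 / (a b) of their
   parent; these are never all equal, whence the gain 12/7 < sqrt 3. *)
Lemma sum_sqrt_children (a b : R) : 0 < a -> 0 < b ->
  (Num.sqrt (a * (2 * a + b)))^-1 + (Num.sqrt ((a + b) * (2 * a + b)))^-1
    + (Num.sqrt ((a + b) * b))^-1 <= 12 / 7 * (Num.sqrt (a * b))^-1.
Proof.
move=> a0 b0.
have ab0 : 0 < a + b by lra. have aab0 : 0 < 2 * a + b by lra.
have E (x : R) : 0 < x ->
    (Num.sqrt x)^-1 = Num.sqrt (a * b / x) * (Num.sqrt (a * b))^-1.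
  move=> x0; rewrite sqrtrM ?mulr_ge0 1?ltW// mulrAC divff ?mul1r; last first.
    by rewrite gt_eqF// sqrtr_gt0 mulr_gt0.
  by rewrite sqrtrV// ltW.
rewrite (E (a * (2 * a + b))) ?mulr_gt0// (E ((a + b) * (2 * a + b))) ?mulr_gt0//.
rewrite (E ((a + b) * b)) ?mulr_gt0// -!mulrDl.
rewrite ler_wpM2r ?invr_ge0 ?sqrtr_ge0//.
rewrite [X in Num.sqrt X + _ + _](_ : _ = b / (2 * a + b)); last first.
  by field; rewrite !gt_eqF.
rewrite [X in _ + Num.sqrt X](_ : _ = a / (a + b)); last first.
  by field; rewrite !gt_eqF.
set p1 := b / _; set p2 := a * b / _; set p3 := a / (a + b).
have p1_ge0 : 0 <= p1 by rewrite divr_ge0 // ltW.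
have p2_ge0 : 0 <= p2 by rewrite divr_ge0 // mulr_ge0 // ltW.
have p3_ge0 : 0 <= p3 by rewrite divr_ge0 // ltW.
have ps : p1 + p2 + p3 = 1 by rewrite /p1 /p2 /p3; field; rewrite !gt_eqF.
(* With denominators cleared this is (a - b)^2 + a^2 >= 0. *)
have p25 : p2 <= 1 / 5.
  by rewrite /p2 ler_pdivrMr ?mulr_gt0//; have := sqr_ge0 (a - b); have := sqr_ge0 a; nra.
(* The tangent points approximate the square roots of 2/5, 1/5 and 2/5, the extremal fractions under
   [p25]. The resulting bound is about 1.7131, just below 12/7. *)
have s1 := @sqrt_tangent _ (64 / 100) p1_ge0 ltac:(lra).
have s2 := @sqrt_tangent _ (42 / 100) p2_ge0 ltac:(lra).
have s3 := @sqrt_tangent _ (64 / 100) p3_ge0 ltac:(lra).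
lra.
Qed.

Definition invsqrt u := (Num.sqrt (denom u))^-1.

Lemma sum_invsqrt n l u : 1 <= u.1 -> 1 <= u.2 ->
  \sum_(s : n.-tuple label | path allowed l s) invsqrt (weights l u s)
    <= (12 / 7) ^+ n * invsqrt u.
Proof.
move=> u1 u2; apply: sum_words => // a b a1 b1.
exact: (sum_sqrt_children (lt_le_trans ltr01 a1) (lt_le_trans ltr01 b1)).
Qed.

Lemma sum_count n l : 
  \sum_(s : n.-tuple label | path allowed l s) (1 : R) <= 3 ^+ n.
Proof.
rewrite -[leRHS]mulr1 (@sum_words (fun=> 1) 3 _ _ n l (1, 1)) //= => *; lra.
Qed.

End WordTree.

(** * Geometry of the branches *)

Section CircleGeometry.
Variable R : realType.
Implicit Types (z w : circle R) (l : label).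

Definition sgb (b : bool) : R := if b then 1 else -1.

Definition reX z : R := Re (val z).
Definition imY z : R := Im (val z).

Lemma reX_imY z : reX z ^+ 2 + imY z ^+ 2 = 1.
Proof. exact: circle_sqr (norm_circle z). Qed.

(* The quadrants are half-open, each containing only the endpoint that comes
   last counter-clockwise; the map is then injective on each of them, with
   image the union of three quadrants. *)
Definition quadrant z : label :=
  ((0 < reX z) || (reX z == 0) && (0 < imY z),
   (0 < imY z) || (imY z == 0) && (reX z < 0)).

Lemma quadrantP z l : quadrant z = l ->
  [/\ 0 <= sgb l.1 * reX z, 0 <= sgb l.2 * imY z &
   if l.1 == l.2 then 0 < sgb l.2 * imY z else 0 < sgb l.1 * reX z].
Proof.
move=> <-; have := reX_imY z; rewrite /quadrant /sgb /=.
case: (ltgtP (reX z) 0) => [x0|x0|->]; case: (ltgtP (imY z) 0) => [y0|y0|->] //=;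
  rewrite ?eqxx /=; try (by move=> _; split; lra).
by rewrite expr0n /= addr0 => /eqP; rewrite eq_sym oner_eq0.
Qed.

Lemma sgb_sqr b : sgb b * sgb b = 1.
Proof. by case: b; rewrite /sgb; ring. Qed.

Lemma unit_le1 (x y : R) : x ^+ 2 + y ^+ 2 = 1 -> x <= 1.
Proof. by move=> h; nra. Qed.

(* The value is |z - c|^2 for the center c of the circle carrying C_l. *)
Definition sqdist_center l z : R := 3 - 2 * (sgb l.1 * reX z) - 2 * (sgb l.2 * imY z).

(** The center has modulus sqrt 2, so the squared distance is at least (sqrt 2 - 1)^2 = 3 - 2 sqrt 2
    > 1/6. *)
Lemma sqdist_center_ge l z : 1 / 6 <= sqdist_center l z.
Proof.
have := reX_imY z; rewrite /sqdist_center.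
have := sgb_sqr l.1; have := sgb_sqr l.2.
set a := sgb _; set b := sgb _ => aa bb h.
have : (b * reX z) ^+ 2 + (a * imY z) ^+ 2 = 1.
  by rewrite !exprMn !expr2 aa bb !mul1r -!expr2.
move: (b * _) (a * _) => x y {aa bb h}h.
have := sqr_ge0 (x - y); nra.
Qed.

Definition centerl l : R[i] := (sgb l.1 +i* sgb l.2)%C.

Lemma sqr_norm_centerl l : `|centerl l| ^+ 2 = 1 + (1 : R)%:C%C ^+ 2.
Proof.
by rewrite normcC !expr2 !sgb_sqr rmorphD rmorph1 mulr1.
Qed.

Lemma branch_subproof l z :
  `|conjc (reflection (centerl l) 1 (val z))| == 1.
Proof.
rewrite normcJ reflection_norm ?oner_neq0 ?sqr_norm_centerl//.
exact: norm_circle.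
Qed.

(** All four branches take this form: [g1V] and [g2V] conjugate first and invert second, and
    exchanging the two operations replaces the center by its conjugate. *)
Definition branch l z : circle R :=
  exist _ (conjc (reflection (centerl l) 1 (val z))) (branch_subproof l z).

Lemma branchE l z (x := sgb l.1 * reX z) (y := sgb l.2 * imY z) :
  reX (branch l z) = sgb l.1 * (2 - x - 2 * y) / sqdist_center l z /\
  imY (branch l z) = sgb l.2 * (2 * x + y - 2) / sqdist_center l z.
Proof.
rewrite {}/x {}/y.
have E0 : sqdist_center l z != 0.
  by rewrite gt_eqF// (lt_le_trans _ (sqdist_center_ge l z)).
have := reX_imY z; move: E0; rewrite /sqdist_center /reX /imY /=.
have := sgb_sqr l.1; have := sgb_sqr l.2.
case: (val z) => X Y; rewrite /reflection /centerl /=.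
set s := sgb l.1; set t := sgb l.2 => tt ss.
rewrite ?expr1n /= => E0 h.
have -> : (X - s) ^+ 2 + (- (Y - t)) ^+ 2 = 3 - 2 * (s * X) - 2 * (t * Y).
  by nra.
set E := 3 - _ - _ in E0 *.
split; apply: (mulIf E0); rewrite divfK//.
  transitivity (s * E + ((X - s) / E) * E); first by ring.
  by rewrite divfK // /E; have := congr1 ( *%R^~ X) ss; rewrite mul1r; lra.
transitivity (- t * E + (- (Y - t) / E) * E); first by ring.
by rewrite divfK // /E; have := congr1 ( *%R^~ Y) tt; rewrite mul1r; lra.
Qed.

Lemma bowen_series_branch l z :
  0 <= sgb l.1 * reX z -> 0 <= sgb l.2 * imY z -> bowen_series z = branch l z.
Proof.
have [h1 h2 h3 h4] := bowen_seriesE z.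
have z1 := norm_circle z.
move=> x0 y0; apply: val_inj; rewrite [RHS]/=.
case: l x0 y0 => [[] []]; rewrite /sgb /= ?mul1r ?mulN1r ?oppr_ge0 => x0 y0.
- exact: h1.
- rewrite [LHS]h3; last by apply/arc1VE.
  rewrite /g1V /reflection /center1 /centerl /=; case: (val z) => X Y /=.
  by apply/eqP; rewrite eq_complex /=; apply/andP; split; apply/eqP;
    rewrite ?expr1n /= ?opprK -?opprD ?sqrrN /=; ring.
- exact: h2.
rewrite [LHS]h4; last by apply/arc2VE.
rewrite /g2V /reflection /center2 /centerl /=; case: (val z) => X Y /=.
by apply/eqP; rewrite eq_complex /=; apply/andP; split; apply/eqP;
    rewrite ?expr1n /= ?opprK -?opprD ?sqrrN /=; ring.
Qed.

End CircleGeometry.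

(** * Linear coordinates for the map and lengths of arcs *)

Section CircleDynamics.
Variable R : realType.
Implicit Types (z w : circle R) (l : label).

Lemma abs_sgb (b : bool) (x : R) : 0 <= sgb R b * x -> `|x| = sgb R b * x.
Proof. by case: b; rewrite /sgb => x0; [rewrite ger0_norm|rewrite ler0_norm]; lra. Qed.

Lemma sgb_neg b : sgb R (~~ b) = - sgb R b.
Proof. by case: b; rewrite /sgb /= ?opprK. Qed.

Lemma abs_quadrant z l : quadrant z = l ->
  `|reX z| = sgb R l.1 * reX z /\ `|imY z| = sgb R l.2 * imY z.
Proof. by move=> /quadrantP[x0 y0 _]; split; exact: abs_sgb. Qed.

Lemma abs_unit z : `|reX z| ^+ 2 + `|imY z| ^+ 2 = 1.
Proof. by rewrite !real_normK ?num_real// reX_imY. Qed.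

Lemma bowen_series_quadrant z (x := `|reX z|) (y := `|imY z|) (l := quadrant z) :
  [/\ 0 < 3 - 2 * x - 2 * y,
   sgb R l.1 * reX (bowen_series z) * (3 - 2 * x - 2 * y) = 2 - x - 2 * y &
   sgb R l.2 * imY (bowen_series z) * (3 - 2 * x - 2 * y) = 2 * x + y - 2].
Proof.
have [x0 y0 _] := quadrantP (erefl (quadrant z)).
rewrite (bowen_series_branch x0 y0) /x /y.
have [-> ->] := abs_quadrant (erefl (quadrant z)).
have [-> ->] := branchE (quadrant z) z.
have E0 : 0 < sqdist_center (quadrant z) z.
  by apply: lt_le_trans (sqdist_center_ge _ _).
rewrite -/l -/(sqdist_center l z); split => //.
- by rewrite 2!mulrA sgb_sqr mul1r divfK // gt_eqF.
- by rewrite 2!mulrA sgb_sqr mul1r divfK // gt_eqF.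
Qed.

Lemma allowed_quadrant z : allowed (quadrant z) (quadrant (bowen_series z)).
Proof.
rewrite /allowed; apply/negP => /andP[/eqP e1 e2].
have [E0 eX eY] := bowen_series_quadrant z.
have [_ _ strict] := quadrantP (erefl (quadrant z)).
have := quadrantP (erefl (quadrant (bowen_series z))).
have -> : (quadrant (bowen_series z)).2 = ~~ (quadrant z).2.
  by move: e2; case: (quadrant z).2; case: (quadrant _).2.
rewrite -e1 sgb_neg => -[x1 y1 strict'].
have [hx hy] := abs_quadrant (erefl (quadrant z)).
have := abs_unit z; move: strict strict' x1 y1 eX eY E0; rewrite -hx -hy.
have -> : ((quadrant z).1 == ~~ (quadrant z).2) = ~~ ((quadrant z).1 == (quadrant z).2).
  by case: (quadrant z).1; case: (quadrant z).2.
have : 0 <= `|reX z| by []. have : 0 <= `|imY z| by [].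
move: `|reX z| `|imY z| => x y y0 x0.
rewrite mulNr; move: (sgb _ _ * _) (sgb _ _ * _) => x' y'.
move=> st st' x1 y1 eX eY E0 xy.
(* On the unit circle, [A] forces x = 0 or x >= 4/5 and [B] forces y = 0 or y >= 4/5. Since 2
   (4/5)^2 > 1, only (0, 1) and (1, 0) remain, and the strict inequalities of the half-open
   quadrants exclude these. *)
have A : 0 <= 2 - x - 2 * y by rewrite -eX mulr_ge0// ltW.
have B : 0 <= 2 - 2 * x - y by nra.
have A2 : 0 <= x * (5 * x - 4) by nra.
have B2 : 0 <= y * (5 * y - 4) by nra.
move: st st'; case: eqP => _ /= st st'.
  have A' : 0 < 2 - x - 2 * y by rewrite -eX mulr_gt0.
  have A2' : 0 < x * (5 * x - 4) by nra.
  have : 4 / 5 < x by nra.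
  have : 4 / 5 <= y by nra.
  by nra.
have B' : 0 < 2 - 2 * x - y by nra.
have B2' : 0 < y * (5 * y - 4) by nra.
have : 4 / 5 <= x by nra.
have : 4 / 5 < y by nra.
by nra.
Qed.

(** The vector (1 + |x|, |y|) is a multiple of a square root of |x| + i|y|, and it is the
    combination of (1, 0) and (1, 1), the vectors over 1 and i, with coefficients [pa] and [pb]. *)
Definition pa z := 1 + `|reX z| - `|imY z|.
Definition pb z := `|imY z|.

(** The l1 norm is additive on nonnegative vectors, so this is the norm of the combination with
    coefficients [pa z] and [pb z] of two such vectors with norms [u]. *)
Definition pairing (u : R * R) z := u.1 * pa z + u.2 * pb z.

Definition pdet z w := pa z * pb w - pb z * pa w.

(** This is [c] times the transpose of the linear map [child l l'], as [pairing_parent]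
    expresses. *)
Definition parent_coords (l l' : label) (c a b : R) : R * R :=
  if l.1 == l'.1 then (c * (a + 2 * b), c * b)
  else if l.2 == l'.2 then (c * (a + 2 * b), c * (a + b))
  else (c * a, c * (a + b)).

(* (pa z, pb z) is proportional to the coordinates of a square root of z with
   respect to integer vectors spanning the endpoints of its quadrant, on which
   the branches act linearly. *)
Lemma bowen_series_coords z (w := bowen_series z) :
  exists2 c, 0 <= c & (pa z, pb z) = parent_coords (quadrant z) (quadrant w) c (pa w) (pb w).
Proof.
have [] := bowen_series_quadrant z; have := allowed_quadrant z.
rewrite /allowed -/w; have := abs_unit z; rewrite /pa /pb.
have [] := abs_quadrant (erefl (quadrant w)).
have : 0 <= `|reX w| by []. have : 0 <= `|imY w| by [].
have : 0 <= `|reX z| by []. have : 0 <= `|imY z| by [].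
move: `|reX z| `|imY z| `|reX w| `|imY w| => x y x' y' y0 x0 y0' x0' hx hy xy.
move: (quadrant z) (quadrant w) hx hy => [s t] [s' t'] /= hx hy /nandP al E0 eX eY.
have {}eX : (if s == s' then x' else - x') * (3 - 2 * x - 2 * y) = 2 - x - 2 * y.
  rewrite -eX hx; case: (s) (s') => -[]; rewrite /sgb /=; ring.
have {}eY : (if t == t' then y' else - y') * (3 - 2 * x - 2 * y) = 2 * x + y - 2.
  rewrite -eY hy; case: (t) (t') => -[]; rewrite /sgb /=; ring.
rewrite /parent_coords /=; have x1 : 0 < 1 + x' by lra.
have D0 : (1 + x') * (3 - 2 * x - 2 * y) != 0 by rewrite gt_eqF// mulr_gt0.
have D1 : (1 + x') * (3 - 2 * x - 2 * y) =
    3 - 2 * x - 2 * y + x' * (3 - 2 * x - 2 * y) by rewrite mulrDl mul1r.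
have frac N : N / (1 + x') * y' * ((1 + x') * (3 - 2 * x - 2 * y)) =
    N * (y' * (3 - 2 * x - 2 * y)).
  by field; rewrite gt_eqF.
(* Since [pa w + pb w] is 1 + x', the factor c is read off from [pa z - pb z] in the first case and
   from [pb z] in the other two. *)
move: al eX eY; case: eqP => _ /=; last case: eqP => _ /=; rewrite ?mulNr.
- case=> // /negPn ->; move=> eX eY; exists ((1 + x - 2 * y) / (1 + x')).
    by rewrite divr_ge0 ?(ltW x1)//; nra.
  have h : y = (1 + x - 2 * y) / (1 + x') * y'.
    apply: (mulIf D0); rewrite frac D1; clear -xy eX eY.
    by rewrite eX eY; lra.
  congr pair => //.
  transitivity ((1 + x - 2 * y) / (1 + x') * (1 + x') + (1 + x - 2 * y) / (1 + x') * y').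
    by rewrite divfK ?gt_eqF// -h; lra.
  by ring.
- move=> _ eX eY; exists (y / (1 + x')); first by rewrite divr_ge0 ?(ltW x1).
  have h : 1 + x - 2 * y = y / (1 + x') * y'.
    apply: (mulIf D0); rewrite frac D1; clear -xy eX eY.
    by rewrite eY -[x' * _]opprK eX; lra.
  congr pair.
    transitivity (y / (1 + x') * (1 + x') + y / (1 + x') * y'); last by ring.
    by rewrite divfK ?gt_eqF// -h; lra.
  transitivity (y / (1 + x') * (1 + x')); last by ring.
  by rewrite divfK ?gt_eqF.
move=> _ eX eY; exists (y / (1 + x')); first by rewrite divr_ge0 ?(ltW x1).
have h : 2 * y - 1 - x = y / (1 + x') * y'.
  apply: (mulIf D0); rewrite frac D1; clear -xy eX eY.
    by rewrite -[x' * _]opprK -[y' * _]opprK eX eY; lra.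
congr pair.
  transitivity (y / (1 + x') * (1 + x') - y / (1 + x') * y'); last by ring.
  by rewrite divfK ?gt_eqF// -h; lra.
transitivity (y / (1 + x') * (1 + x')); last by ring.
by rewrite divfK ?gt_eqF.
Qed.

Definition itin (n : nat) z : seq label :=
  [seq quadrant x | x <- traject (@bowen_series R) z n].

Lemma pa_ge0 z : 0 <= pa z.
Proof.
rewrite /pa; have := abs_unit z; have : 0 <= `|reX z| by []; have : 0 <= `|imY z| by [].
by move: `|reX z| `|imY z| => x y; nra.
Qed.

Lemma pb_ge0 z : 0 <= pb z. Proof. exact: normr_ge0. Qed.

Lemma pairing_parent l l' (u : R * R) c a b :
  u.1 * (parent_coords l l' c a b).1 + u.2 * (parent_coords l l' c a b).2 =
  c * ((child l l' u).1 * a + (child l l' u).2 * b).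
Proof.
by rewrite /parent_coords /child; case: eqP => _ /=; last (case: eqP => _ /=); ring.
Qed.

(** The three coordinate changes have determinant 1, -1 and 1, so only the scaling factors
    survive. *)
Lemma det_parent l l' c a b d a' b' :
  `|(parent_coords l l' c a b).1 * (parent_coords l l' d a' b').2
     - (parent_coords l l' c a b).2 * (parent_coords l l' d a' b').1|
  = `|c * d * (a * b' - b * a')|.
Proof.
rewrite /parent_coords; case: eqP => _ /=; last (case: eqP => _ /=).
- by congr `| _ |; ring.
- by rewrite -normrN; congr `| _ |; ring.
- by congr `| _ |; ring.
Qed.

(** For a single letter this bounds a determinant of nonnegative entries by the product of the
    norms. Pulling back along a common branch multiplies the determinant and the product of pairings
    by the same factor [c * d]. A word of n + 1 letters involves n subdivisions, hence [behead]. *)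
Lemma itin_pdet n z w (u : R * R) : itin n.+1 z = itin n.+1 w -> 1 <= u.1 -> 1 <= u.2 ->
  `|pdet z w| * denom (weights (quadrant z) u (behead (itin n.+1 z)))
    <= pairing u z * pairing u w.
Proof.
elim: n z w u => [|n IH] z w u /=.
  move=> _ u1 u2; rewrite /pairing /denom /pdet.
  have := pa_ge0 z; have := pa_ge0 w; have := pb_ge0 z; have := pb_ge0 w.
  case: u u1 u2 => a b /= a1 b1; move: (pa z) (pb z) (pa w) (pb w) => p q p' q' q'0 q0 p'0 p0.
  have ab0 : 0 <= a * b by nra.
  have aa0 : 0 <= a * a by nra.
  have bb0 : 0 <= b * b by nra.
  have h1 : 0 <= p * q' by nra.
  have h2 : 0 <= q * p' by nra.
  have : `|p * q' - q * p'| * (a * b) <= (p * q' + q * p') * (a * b).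
    by rewrite ler_wpM2r// ler_norml; lra.
  have := mulr_ge0 aa0 (mulr_ge0 p0 p'0); have := mulr_ge0 bb0 (mulr_ge0 q0 q'0).
  by lra.
move=> e u1 u2.
have [v1 v2 _] := child_ge1 (quadrant z) (quadrant (bowen_series z)) u1 u2.
have eq' : itin n.+1 (bowen_series z) = itin n.+1 (bowen_series w) := congr1 behead e.
have eq0 : quadrant z = quadrant w := congr1 (head (quadrant z)) e.
have eq1 : quadrant (bowen_series z) = quadrant (bowen_series w) :=
  congr1 (head (quadrant z)) eq'.
have := IH _ _ _ eq' v1 v2; rewrite /=.
have [c c0 ec] := bowen_series_coords z.
have [d d0 ed] := bowen_series_coords w; rewrite -eq0 -eq1 in ed.
rewrite /pairing /pdet -[pa z]/(pa z, pb z).1 -[pb z]/(pa z, pb z).2.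
rewrite -[pa w]/(pa w, pb w).1 -[pb w]/(pa w, pb w).2 ec ed !pairing_parent det_parent.
rewrite normrM (ger0_norm (mulr_ge0 c0 d0)) => h.
by rewrite -[leLHS]mulrA [leRHS]mulrACA ler_wpM2l ?mulr_ge0.
Qed.

Lemma chord_sqr z w :
  chord z w ^+ 2 = (reX z - reX w) ^+ 2 + (imY z - imY w) ^+ 2.
Proof.
rewrite /chord /reX /imY; case: (val z) (val w) => a b [a' b'] /=.
by rewrite sqr_sqrtr// addr_ge0// sqr_ge0.
Qed.

Lemma chord_ge0 z w : 0 <= chord z w.
Proof. by rewrite /chord; case: (_ - _) => a b /=; exact: sqrtr_ge0. Qed.

(** The determinant is y' - y plus the sine of the angle between the points, two terms of equal sign
    on a quarter circle. With d in [0, 1] the cosine, its square is at least 1 - d^2 >= 1 - d, while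
    the squared chord is 2 - 2d. *)
Lemma quarter_circle_det (x y x' y' : R) :
  0 <= x -> 0 <= y -> 0 <= x' -> 0 <= y' ->
  x ^+ 2 + y ^+ 2 = 1 -> x' ^+ 2 + y' ^+ 2 = 1 ->
  (x - x') ^+ 2 + (y - y') ^+ 2 <=
  2 ^+ 2 * ((1 + x - y) * y' - y * (1 + x' - y')) ^+ 2.
Proof.
move=> x0 y0 x'0 y'0 h h'.
have d0 : 0 <= x * x' + y * y' by rewrite addr_ge0 ?mulr_ge0.
have d1 : (x * y' - x' * y) ^+ 2 = 1 - (x * x' + y * y') ^+ 2.
  by rewrite -[1]mulr1 -{1}h -h'; ring.
have s : 0 <= (y' - y) * (x * y' - x' * y).
  have [yy|/ltW yy] := leP y y'.
    have xx : x' <= x.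
      have : y ^+ 2 <= y' ^+ 2 by rewrite ler_sqr ?nnegrE.
      by move=> ?; rewrite -ler_sqr ?nnegrE//; lra.
    rewrite mulr_ge0 ?subr_ge0//.
    by rewrite (le_trans (ler_wpM2r y0 xx))// ler_wpM2l.
  have xx : x <= x'.
    have : y' ^+ 2 <= y ^+ 2 by rewrite ler_sqr ?nnegrE.
    by move=> ?; rewrite -ler_sqr ?nnegrE//; lra.
  rewrite -mulrNN mulr_ge0 ?oppr_ge0 ?subr_le0//.
  by rewrite (le_trans (ler_wpM2l x0 yy))// ler_wpM2r.
have d2 : x * x' + y * y' <= 1.
  by have := sqr_ge0 (x - x'); have := sqr_ge0 (y - y'); nra.
have : (1 + x - y) * y' - y * (1 + x' - y') = (y' - y) + (x * y' - x' * y).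
  by ring.
move=> ->; rewrite [(_ + (x * y' - x' * y)) ^+ 2]sqrrD d1.
have := sqr_ge0 (y' - y).
have : 0 <= (x * x' + y * y') * (1 - (x * x' + y * y')).
  by rewrite mulr_ge0// subr_ge0.
have -> : (x - x') ^+ 2 + (y - y') ^+ 2 = 2 - 2 * (x * x' + y * y').
  by lra.
move: (y' - y) (x * y' - x' * y) (x * x' + y * y') s => p q d s; nra.
Qed.

Lemma chord_pdet z w : quadrant z = quadrant w -> chord z w <= 2 * `|pdet z w|.
Proof.
move=> e; rewrite -ler_sqr ?nnegrE ?mulr_ge0 ?chord_ge0//.
rewrite exprMn real_normK ?num_real// chord_sqr /pdet /pa /pb.
have [zx zy] := abs_quadrant (erefl (quadrant z)).
have [wx wy] := abs_quadrant (esym e).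
have -> : (reX z - reX w) ^+ 2 = (`|reX z| - `|reX w|) ^+ 2.
  by rewrite zx wx -mulrBr exprMn [sgb _ _ ^+ 2]expr2 sgb_sqr mul1r.
have -> : (imY z - imY w) ^+ 2 = (`|imY z| - `|imY w|) ^+ 2.
  by rewrite zy wy -mulrBr exprMn [sgb _ _ ^+ 2]expr2 sgb_sqr mul1r.
by apply: quarter_circle_det => //; exact: abs_unit.
Qed.

(** The initial norms (1, 2) are those of (1, 0) and (1, 1). The constant is 2 * 3 * 3: a factor 2
    from [chord_pdet], and [pairing (1, 2)], which is 1 + |x| + |y|, is at most 3 at both points. *)
Lemma chord_itin n z w : itin n.+1 z = itin n.+1 w ->
  chord z w * denom (weights (quadrant z) (1, 2) (behead (itin n.+1 z))) <= 18.
Proof.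
move=> e; have q : quadrant z = quadrant w := congr1 (head (quadrant z)) e.
have two : 1 <= 2 :> R by rewrite ler1n.
have [_ _ D] := @weights_ge1 R (quadrant z) (1, 2) (behead (itin n.+1 z)) (lexx 1) two.
have D0 : 0 <= denom (weights (quadrant z) (1 : R, 2) (behead (itin n.+1 z))).
  by apply: (le_trans _ D); rewrite /denom /= mul1r addr_ge0.
have H := itin_pdet e (lexx 1 : 1 <= (1, 2 : R).1) two.
apply: le_trans (ler_wpM2r D0 (chord_pdet q)) _; rewrite -mulrA.
suff : pairing (1, 2) z * pairing (1, 2) w <= 9.
  by lra.
have P x : 0 <= pairing (1, 2) x <= 3.
  have := pa_ge0 x; have := pb_ge0 x; have := abs_unit x; rewrite /pairing /pa /pb /=.
  by move: `|reX x| `|imY x| => s t h; nra.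
have := P z; have := P w; nra.
Qed.

End CircleDynamics.

(** * Inverse branches, separation of fibers and Lipschitz bounds *)

Section CircleFibers.
Variable R : realType.
Implicit Types (z w : circle R) (l : label).

Definition conjl l : label := (l.1, ~~ l.2).

Lemma conjlK : involutive conjl.
Proof. by case=> a b; rewrite /conjl /= negbK. Qed.

Lemma centerl_conj l : centerl R (conjl l) = conjc (centerl R l).
Proof. by rewrite /centerl /conjl /= sgb_neg. Qed.

Lemma branchK l w : branch l (branch (conjl l) w) = w.
Proof.
apply: val_inj; rewrite -[LHS]/(conjc (reflection (centerl R l) 1
  (conjc (reflection (centerl R (conjl l)) 1 (val w))))) centerl_conj.
have nc : conjc (val w) != centerl R l.
  apply/eqP => h; have := sqr_norm_centerl R l.
  rewrite -h normcJ norm_circle expr1n -{1}[1]addr0 => /addrI /esym/eqP.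
  by rewrite oner_eq0.
have -> : conjc (reflection (conjc (centerl R l)) 1 (val w)) =
    reflection (centerl R l) 1 (conjc (val w)).
  have cD (a b : R[i]) : conjc (a + b) = conjc a + conjc b by exact: rmorphD.
  have cN (a : R[i]) : conjc (- a) = - conjc a by exact: rmorphN.
  have cM (a b : R[i]) : conjc (a * b) = conjc a * conjc b by exact: rmorphM.
  have cV (a : R[i]) : conjc a^-1 = (conjc a)^-1 by exact: fmorphV.
  have c1 : conjc (1%:C%C ^+ 2) = 1%:C%C ^+ 2 :> R[i] by rewrite expr1n; exact: rmorph1.
  by rewrite /reflection cD cM cV c1 !cD !cN !conjcK.
by rewrite reflectionK ?oner_neq0 // conjcK.
Qed.

Lemma branch_quadrant l w : allowed l (quadrant w) ->
  0 <= sgb R l.1 * reX (branch (conjl l) w) /\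
  0 <= sgb R l.2 * imY (branch (conjl l) w).
Proof.
move=> lw; have := sqdist_center_ge (conjl l) w.
have [-> ->] := branchE (conjl l) w; rewrite /sqdist_center /= sgb_neg.
have [x0 y0 _] := quadrantP (erefl (quadrant w)).
have xs : (sgb R l.1 * reX w) ^+ 2 + (sgb R l.2 * imY w) ^+ 2 = 1.
  by rewrite !exprMn [sgb _ l.1 ^+ 2]expr2 [sgb _ l.2 ^+ 2]expr2 !sgb_sqr !mul1r reX_imY.
(* The point [w] lies outside the quadrant conjugate to [l]; in either alternative both numerators
   of the branch are nonnegative. *)
have pq : sgb R l.1 * reX w <= 0 \/ 0 <= sgb R l.2 * imY w.
  move: lw; rewrite /allowed; case: eqP => [e1|ne1].
    by rewrite negbK => /eqP ->; right.
  move=> _; left.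
  have -> : l.1 = ~~ (quadrant w).1.
    by move: ne1; case: (l.1) (quadrant w).1 => -[].
  by rewrite sgb_neg mulNr oppr_le0.
move: xs pq; rewrite !mulNr [sgb R l.2 * - _]mulrN.
set p := sgb R l.1 * reX w; set q := sgb R l.2 * imY w => xs pq E0.
have E1 : 0 < 3 - 2 * p - 2 * - q by lra.
have p1 := unit_le1 xs.
have q1 : - q <= 1 by apply: (@unit_le1 _ _ p); rewrite sqrrN addrC.
split; first by rewrite 2!mulrA sgb_sqr mul1r divr_ge0 ?(ltW E1)//; case: pq; lra.
rewrite 2!mulrA sgb_sqr mul1r -mulNr divr_ge0 ?(ltW E1)//; case: pq; lra.
Qed.

Lemma bowen_series_branchK l w : allowed l (quadrant w) ->
  bowen_series (branch (conjl l) w) = w.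
Proof.
by move=> /branch_quadrant[x0 y0]; rewrite (bowen_series_branch x0 y0) branchK.
Qed.

Lemma chord_gt1 z w :
  1 < (reX z - reX w) ^+ 2 + (imY z - imY w) ^+ 2 -> 1 < chord z w.
Proof.
move=> h; rewrite -[_ < _]ltr_sqr ?nnegrE ?chord_ge0//.
by rewrite expr1n chord_sqr.
Qed.

Lemma sqr_gt1 b (x : R) : 1 < sgb R b * x -> 1 < x ^+ 2.
Proof.
move=> h; have : 1 < (sgb R b * x) ^+ 2 by nra.
by rewrite exprMn [sgb R b ^+ 2]expr2 sgb_sqr mul1r.
Qed.

Lemma half_lt b (A E : R) : 0 < E -> E < 2 * A ->
  1 / 2 < sgb R b * (sgb R b * A / E).
Proof. by move=> E0 EA; rewrite 2!mulrA sgb_sqr mul1r ltr_pdivlMr//; lra. Qed.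

(** If the labels differ in one sign, admissibility of both fixes a sign of [v], which pushes the
    corresponding coordinates of the preimages beyond 1/2 on opposite sides. For opposite quadrants
    the inner product is at most 0, so the squared distance is at least 2. *)
Lemma chord_branch l l' (v : circle R) : allowed l (quadrant v) -> allowed l' (quadrant v) ->
  l != l' -> 1 < chord (branch (conjl l) v) (branch (conjl l') v).
Proof.
move=> az aw ll; apply: chord_gt1.
have [vx vy _] := quadrantP (erefl (quadrant v)).
have [zX zY] := branchE (conjl l) v.
have [wX wY] := branchE (conjl l') v.
have zE := sqdist_center_ge (conjl l) v.
have wE := sqdist_center_ge (conjl l') v.
have [x0 y0] := branch_quadrant az.
have [x0' y0'] := branch_quadrant aw.
move: x0 y0 x0' y0' az aw ll vx vy zX zY wX wY zE wE; rewrite /sqdist_center.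
move: (branch (conjl l) v) (branch (conjl l') v) => z w.
have := reX_imY z; have := reX_imY w.
move: l l' (quadrant v) => [a b] [a' b'] [c d] /= hw hz.
rewrite /allowed /= => x0 y0 x0' y0' az aw ll vx vy zX zY wX wY zE wE.
have E0 : 0 < 3 - 2 * (sgb R a * reX v) - 2 * (sgb R (~~ b) * imY v).
  by clear -zE; lra.
have E0' : 0 < 3 - 2 * (sgb R a' * reX v) - 2 * (sgb R (~~ b') * imY v).
  by clear -wE; lra.
case: (eqVneq a' a) ll => [ea|na] ll.
  subst a'; have eb : b' = ~~ b by move: ll; rewrite xpair_eqE eqxx /=; case: (b) (b') => -[].
  have ca : c = ~~ a by move: az aw; rewrite eb; case: (a) (b) (c) (d) => -[] [] [].
  have p0 : sgb R a * reX v <= 0 by move: vx; rewrite ca sgb_neg mulNr oppr_ge0.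
  have h1 : 1 / 2 < sgb R b * imY z.
    rewrite zY -[X in sgb R X * _]negbK [sgb R (~~ ~~ b)]sgb_neg.
    have := @half_lt (~~ b) (2 - 2 * (sgb R a * reX v) - sgb R (~~ b) * imY v) _ E0.
    by clear -p0; move=> /(_ ltac:(lra)); congr (_ < _); ring.
  have h2 : 1 / 2 < sgb R b' * imY w.
    rewrite wY -[X in sgb R X * _]negbK [sgb R (~~ ~~ b')]sgb_neg.
    have := @half_lt (~~ b') (2 - 2 * (sgb R a * reX v) - sgb R (~~ b') * imY v) _ E0'.
    by clear -p0; move=> /(_ ltac:(lra)); congr (_ < _); ring.
  have h : 1 < (imY z - imY w) ^+ 2.
    by apply: (@sqr_gt1 b); move: h1 h2; rewrite eb sgb_neg; clear; lra.
  by rewrite (lt_le_trans h)// lerDr sqr_ge0.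
have ea : a' = ~~ a by move: na; case: (a) (a') => -[].
case: (eqVneq b' b) => [eb|nb].
  subst b'.
  have db : d = b by move: az aw; rewrite ea; case: (a) (b) (c) (d) => -[] [] [].
  have q0 : sgb R (~~ b) * imY v <= 0 by rewrite sgb_neg mulNr oppr_le0 -db.
  have h1 : 1 / 2 < sgb R a * reX z by rewrite zX; apply: half_lt => //; clear -q0; lra.
  have h2 : 1 / 2 < sgb R a' * reX w by rewrite wX; apply: half_lt => //; clear -q0; lra.
  have h : 1 < (reX z - reX w) ^+ 2.
    by apply: (@sqr_gt1 a); move: h1 h2; rewrite ea sgb_neg; clear; lra.
  by rewrite (lt_le_trans h)// lerDl sqr_ge0.
have eb : b' = ~~ b by move: nb; case: (b) (b') => -[].
move: x0' y0'; rewrite ea eb !sgb_neg !mulNr !oppr_ge0 => x0' y0'.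
have xx : reX z * reX w <= 0.
  rewrite -[leLHS]mul1r -(sgb_sqr R a) mulrACA; exact: mulr_ge0_le0.
have yy : imY z * imY w <= 0.
  rewrite -[leLHS]mul1r -(sgb_sqr R b) mulrACA; exact: mulr_ge0_le0.
by clear -hw hz xx yy; lra.
Qed.

Lemma chord_fiber z w : bowen_series z = bowen_series w -> z != w ->
  1 < chord z w.
Proof.
move=> e zw.
have az := allowed_quadrant z; have aw := allowed_quadrant w.
have [x0 y0 _] := quadrantP (erefl (quadrant z)).
have [x0' y0' _] := quadrantP (erefl (quadrant w)).
have bz : z = branch (conjl (quadrant z)) (bowen_series z).
  by rewrite (bowen_series_branch x0 y0) -{2}[quadrant z]conjlK branchK.
have bw : w = branch (conjl (quadrant w)) (bowen_series z).
  by rewrite e (bowen_series_branch x0' y0') -{2}[quadrant w]conjlK branchK.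
rewrite bz bw; apply: chord_branch => //; first by rewrite e.
by apply: contra zw => /eqP h; apply/eqP; rewrite bz bw h.
Qed.

(** Inversion of radius 1 divides the distance of two points by the product of their distances to
    the center; the squares of the latter are at least 1/6. *)
Lemma branch_lipschitz l z w : chord (branch l z) (branch l w) <= 6 * chord z w.
Proof.
rewrite -[_ <= _]ler_sqr ?nnegrE ?mulr_ge0 ?chord_ge0// exprMn !chord_sqr.
have [-> ->] := branchE l z; have [-> ->] := branchE l w.
have := sqdist_center_ge l w; have := sqdist_center_ge l z; rewrite /sqdist_center.
have sub b (x y E F : R) : (sgb R b * x / E - sgb R b * y / F) ^+ 2 = (x / E - y / F) ^+ 2.
  by rewrite -!mulrA -mulrBr exprMn [sgb R b ^+ 2]expr2 sgb_sqr mul1r.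
have sub' b (x y : R) : (x - y) ^+ 2 = (sgb R b * x - sgb R b * y) ^+ 2.
  by rewrite -mulrBr exprMn [sgb R b ^+ 2]expr2 sgb_sqr mul1r.
rewrite !sub (sub' l.1 (reX z)) (sub' l.2 (imY z)).
have un (v : circle R) : (sgb R l.1 * reX v) ^+ 2 + (sgb R l.2 * imY v) ^+ 2 = 1.
  by rewrite !exprMn [sgb _ l.1 ^+ 2]expr2 [sgb _ l.2 ^+ 2]expr2 !sgb_sqr !mul1r reX_imY.
move: (un z) (un w); clear sub sub' un.
move: (sgb R l.1 * reX z) (sgb R l.2 * imY z) (sgb R l.1 * reX w) (sgb R l.2 * imY w).
move=> x y x' y' h h'; set E := 3 - _ - _; set F := 3 - _ - _ => E6 F6.
have E0 : 0 < E by lra.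
have F0 : 0 < F by lra.
have EF : 0 < E * F by rewrite mulr_gt0.
have EE : E * E^-1 = 1 by rewrite divff ?gt_eqF.
have FF : F * F^-1 = 1 by rewrite divff ?gt_eqF.
have -> : (2 - x - 2 * y) / E = 1 + (x - 1) / E.
  by rewrite /E; field; rewrite gt_eqF.
have -> : (2 - x' - 2 * y') / F = 1 + (x' - 1) / F.
  by rewrite /F; field; rewrite gt_eqF.
have -> : (2 * x + y - 2) / E = - (1 + (y - 1) / E).
  by rewrite /E; field; rewrite gt_eqF.
have -> : (2 * x' + y' - 2) / F = - (1 + (y' - 1) / F).
  by rewrite /F; field; rewrite gt_eqF.
rewrite -(ler_pM2l EF).
apply: (@le_trans _ _ ((x - x') ^+ 2 + (y - y') ^+ 2)).
  have eE : (x - 1) ^+ 2 + (y - 1) ^+ 2 = E by rewrite /E; lra.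
  have eF : (x' - 1) ^+ 2 + (y' - 1) ^+ 2 = F by rewrite /F; lra.
  rewrite le_eqVlt; apply/orP; left; apply/eqP.
  transitivity (E * E^-1 * F / E * ((x - 1) ^+ 2 + (y - 1) ^+ 2)
      + F * F^-1 * E / F * ((x' - 1) ^+ 2 + (y' - 1) ^+ 2)
      - 2 * (E * E^-1) * (F * F^-1) * ((x - 1) * (x' - 1) + (y - 1) * (y' - 1))).
    by ring.
  rewrite EE FF eE eF !mul1r !mulr1 !divfK ?gt_eqF// -eE -eF; ring.
rewrite mulrA ler_peMl ?addr_ge0 ?sqr_ge0//.
have : (1 / 6) * (1 / 6) <= E * F by apply: ler_pM.
lra.
Qed.

End CircleFibers.

(** * Measurability of the quadrants and of the map *)

Section CircleMeasurability.
Variable R : realType.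
Implicit Types (z w : circle R) (l : label).

Lemma circle_openP (U : set (circle R)) :
  open U <-> forall z, U z -> exists2 e : R, 0 < e & forall w, chord z w < e -> U w.
Proof.
rewrite openE; split=> [h z Uz|h z Uz].
  by have /nbhs_ballP[e e0 eU] := h z Uz; exists e => // w zw; apply: eU.
by have [e e0 eU] := h z Uz; apply/nbhs_ballP; exists e => // w zw; exact: eU.
Qed.

Lemma measurable_open (U : set (circle R)) : open U -> measurable U.
Proof. exact: sub_sigma_algebra. Qed.

Lemma lipschitz_preimage_open (f : circle R -> circle R) (k : R) : 0 < k ->
  (forall z w, chord (f z) (f w) <= k * chord z w) ->
  forall U, open U -> open (f @^-1` U).
Proof.
move=> k0 fk U /circle_openP oU; apply/circle_openP => z /oU[e e0 eU].
exists (e / k); first exact: divr_gt0.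
move=> w; rewrite ltr_pdivlMr// mulrC => zw; apply: eU.
exact: le_lt_trans (fk _ _) zw.
Qed.

Lemma measurable_branch l (B : set (circle R)) :
  measurable B -> measurable (branch l @^-1` B).
Proof.
have mf : measurable_fun [set: circle R] (branch (R:=R) l).
  apply: (@measurability _ _ _ _ _ _ (@open (circle R))) => // _ [U oU <-].
  rewrite setTI; apply: measurable_open.
  exact: lipschitz_preimage_open (branch_lipschitz l) _ oU.
by move=> mB; have := mf measurableT _ mB; rewrite setTI.
Qed.

Lemma chord_reX z w : `|reX z - reX w| <= chord z w.
Proof.
rewrite -[_ <= _]ler_sqr ?nnegrE ?chord_ge0// chord_sqr real_normK ?num_real//.
by rewrite lerDl sqr_ge0.
Qed.

Lemma chord_imY z w : `|imY z - imY w| <= chord z w.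
Proof.
rewrite -[_ <= _]ler_sqr ?nnegrE ?chord_ge0// chord_sqr real_normK ?num_real//.
by rewrite lerDr sqr_ge0.
Qed.

Lemma measurable_lipschitz_pos (h : circle R -> R) :
  (forall z w, `|h z - h w| <= chord z w) -> measurable [set z | 0 < h z].
Proof.
move=> hc; apply: measurable_open; apply/circle_openP => z hz; exists (h z) => //= w zw.
by have := le_lt_trans (hc z w) zw; rewrite ltr_norml; lra.
Qed.

Lemma measurable_lipschitz_neg (h : circle R -> R) :
  (forall z w, `|h z - h w| <= chord z w) -> measurable [set z | h z < 0].
Proof.
move=> hc; rewrite (_ : mkset _ = [set z | 0 < - h z]).
  apply: (@measurable_lipschitz_pos (fun z => - h z)) => z w.
  by rewrite -opprD normrN.
by apply/seteqP; split => z /=; rewrite oppr_gt0.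
Qed.

Lemma measurable_lipschitz_eq0 (h : circle R -> R) :
  (forall z w, `|h z - h w| <= chord z w) -> measurable [set z | h z == 0].
Proof.
move=> hc; rewrite (_ : mkset _ = ~` ([set z | 0 < h z] `|` [set z | h z < 0])).
  apply/measurableC/measurableU; first exact: measurable_lipschitz_pos.
  exact: measurable_lipschitz_neg.
apply/seteqP; split => z /=; first by move=> /eqP ->; rewrite ltxx => -[].
by case: (ltgtP (h z) 0) => // _ [] //; [right|left].
Qed.

Lemma measurable_quadrant l : measurable [set z : circle R | quadrant z = l].
Proof.
have mx : measurable [set z : circle R | (quadrant z).1].
  rewrite (_ : mkset _ = [set z | 0 < reX z] `|`
      ([set z | reX z == 0] `&` [set z | 0 < imY z])).
    apply: measurableU; last apply: measurableI.
    - exact: measurable_lipschitz_pos chord_reX.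
    - exact: measurable_lipschitz_eq0 chord_reX.
    - exact: measurable_lipschitz_pos chord_imY.
  apply/seteqP; split => z /=; first by move=> /orP[->|/andP[]]; [left|right].
  by rewrite /quadrant /= => -[->|[-> ->]]; rewrite ?orbT.
have my : measurable [set z : circle R | (quadrant z).2].
  rewrite (_ : mkset _ = [set z | 0 < imY z] `|`
      ([set z | imY z == 0] `&` [set z | reX z < 0])).
    apply: measurableU; last apply: measurableI.
    - exact: measurable_lipschitz_pos chord_imY.
    - exact: measurable_lipschitz_eq0 chord_imY.
    - exact: measurable_lipschitz_neg chord_reX.
  apply/seteqP; split => z /=; first by move=> /orP[->|/andP[]]; [left|right].
  by rewrite /quadrant /= => -[->|[-> ->]]; rewrite ?orbT.
have mb (A : set (circle R)) (b : bool) : measurable A -> measurable (if b then A else ~` A).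
  by case: b => //; exact: measurableC.
set A1 := mkset _ in mx; set A2 := mkset _ in my.
rewrite (_ : mkset _ = (if l.1 then A1 else ~` A1) `&` (if l.2 then A2 else ~` A2)).
  by apply: measurableI; apply: mb.
apply/seteqP; split => z /=.
  by move=> <-; split; case: ifP => [|/negbT/negP].
case: l => a b /= [h1 h2]; apply/eqP.
rewrite [quadrant z]surjective_pairing xpair_eqE; apply/andP; split.
  by apply/eqP; case: a h1 => [|/negP/negbTE]; apply.
by apply/eqP; case: b h2 => [|/negP/negbTE]; apply.
Qed.

Lemma measurable_bowen_series (B : set (circle R)) :
  measurable B -> measurable (@bowen_series R @^-1` B).
Proof.
move=> mB; rewrite (_ : _ @^-1` B =
    \big[setU/set0]_(l : label) ([set z : circle R | quadrant z = l] `&` (branch l @^-1` B))).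
  by apply: bigsetU_measurable => l _; apply: measurableI;
    [exact: measurable_quadrant|exact: measurable_branch].
rewrite -bigcup_seq; apply/seteqP; split => z /=.
  move=> Bz; exists (quadrant z); first by rewrite /= mem_index_enum.
  split => //=; have [x0 y0 _] := quadrantP (erefl (quadrant z)).
  by rewrite -(bowen_series_branch x0 y0).
move=> [l _ [/= lz]]; have [x0 y0 _] := quadrantP lz.
by rewrite -(bowen_series_branch x0 y0).
Qed.

End CircleMeasurability.

(** * Topological entropy *)

Section TopologicalEntropyFiber.
Variables (R : realType) (T : metricType R) (f : T -> T).
Variables (x0 : T) (pre : T -> seq T) (m : nat) (eps : R).
Hypothesis (m0 : (0 < m)%N) (eps0 : 0 < eps).
Hypothesis size_pre : forall x, size (pre x) = m.
Hypothesis uniq_pre : forall x, uniq (pre x).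
Hypothesis preK : forall x y, y \in pre x -> f y = x.
Hypothesis sep_fiber : forall x y, f x = f y -> x != y -> eps < mdist x y.

Fixpoint backward_tree (x : T) n : seq T :=
  if n is n'.+1 then [seq z | y <- backward_tree x n', z <- pre y] else [:: x].

Lemma size_backward_tree x n : size (backward_tree x n) = (m ^ n)%N.
Proof.
elim: n => [|n IH] //=; rewrite size_allpairs_dep.
rewrite (eq_map (g := fun=> m)); last by move=> y; rewrite size_pre.
by rewrite sumnE big_map big_const_seq count_predT IH iter_addn_0 expnS.
Qed.

(** Two distinct points of the tree have orbits that merge by time n; just before merging they are
    distinct points of one fiber, hence more than [eps] apart. *)
Lemma backward_tree_separated x n : orbit_separated f n eps (backward_tree x n).
Proof.
elim: n => [|n [un sn]] /=.
  by split => // y z; rewrite !inE => /eqP -> /eqP ->; rewrite eqxx.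
have key y : y \in [seq z | y <- backward_tree x n, z <- pre y] ->
    f y \in backward_tree x n.
  by move=> /allpairsPdep[u [v [us vu ->]]]; rewrite (preK vu).
split.
  apply: allpairs_uniq_dep => //.
  move=> _ _ /allpairsPdep[u [v [_ vu ->]]] /allpairsPdep[u' [v' [_ vu' ->]]] /=.
  by move=> vv; rewrite -(preK vu) -(preK vu') vv.
move=> y z ys zs yz; have [fyz|fyz] := eqVneq (f y) (f z).
  by exists 0%N => //=; exact: sep_fiber.
have [i ni h] := sn _ _ (key y ys) (key z zs) fyz.
by exists i.+1 => //; rewrite !iterSr.
Qed.

Lemma topological_entropy_ge : ((ln m%:R)%:E <= topological_entropy f)%E.
Proof.
apply: (@le_trans _ _ (limn_esup (fun n => ereal_sup
      [set (ln (size s)%:R / n%:R)%:E | s in orbit_separated f n eps]))); last first.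
  by apply: ereal_sup_ubound; exists eps.
rewrite limn_esup_lim; apply: lime_ge; first exact: is_cvg_esups.
(* Each tail starting at k contains the index [k.+1], which is a nonzero divisor. *)
apply: nearW => k; apply: (@le_trans _ _ (ereal_sup
      [set (ln (size s)%:R / k.+1%:R)%:E | s in orbit_separated f k.+1 eps])); last first.
  by apply: ereal_sup_ubound; exists k.+1 => //=.
apply: ereal_sup_ubound; exists (backward_tree x0 k.+1).
  exact: backward_tree_separated.
rewrite size_backward_tree natrX lnXn ?ltr0n// -[ln _ *+ _]mulr_natr.
by rewrite mulfK ?pnatr_eq0.
Qed.

End TopologicalEntropyFiber.

Lemma bowen_series_entropy_ge (R : realType) :
  ((ln 3)%:E <= topological_entropy (@bowen_series R))%E.
Proof.
pose pre (w : circle R) :=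
  [seq branch (conjl l) w | l <- enum [pred l | allowed l (quadrant w)]].
have := @topological_entropy_ge R (circle R) (@bowen_series R) point pre 3 1.
apply => // [w|w|x y|x y].
- rewrite size_map -cardE -sum1_card; case: (quadrant w) => a b.
  rewrite big_mkcond; transitivity (\sum_(p : bool * bool)
      (fun c d => if allowed (c, d) (a, b) then 1 else 0) p.1 p.2)%N.
    by apply: eq_bigr => -[].
  rewrite -(pair_bigA _ (fun c d => if allowed (c, d) (a, b) then 1 else 0)%N) /=.
  by rewrite !big_bool; case: a b => -[].
- rewrite /pre map_inj_in_uniq ?enum_uniq// => l l'; rewrite !mem_enum => al al' e.
  apply/eqP/negPn/negP => ll; have := chord_branch al al' ll.
  by rewrite e /chord subrr Normc.normc0 ltr10.
- by move=> /mapP[l]; rewrite mem_enum => /bowen_series_branchK h ->.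
- exact: chord_fiber.
Qed.

(** * Entropy of finite random variables *)

Section FiniteRandomVariables.
Context {R : realType} {d : measure_display} {T : measurableType d}.
Variable mu : probability T R.

Definition prb (A : set T) : R := fine (mu A).

Lemma prbE A : measurable A -> (prb A)%:E = mu A.
Proof. by move=> mA; rewrite fineK // fin_num_measure. Qed.

Lemma prb_ge0 A : 0 <= prb A. Proof. exact: fine_ge0. Qed.

Lemma prbT : prb setT = 1. Proof. by rewrite /prb probability_setT. Qed.

Lemma prb0 : prb set0 = 0. Proof. by rewrite /prb measure0. Qed.

Lemma le_prb A B : measurable A -> measurable B -> A `<=` B -> prb A <= prb B.
Proof.
by move=> mA mB AB; rewrite -lee_fin !prbE // le_measure // inE.
Qed.

Lemma prb_setC A : measurable A -> prb (~` A) = 1 - prb A.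
Proof.
by move=> mA; apply: EFin_inj; rewrite EFinB !prbE ?probability_setC//; exact: measurableC.
Qed.

Lemma prbU_le A B : measurable A -> measurable B -> prb (A `|` B) <= prb A + prb B.
Proof.
move=> mA mB; rewrite -lee_fin EFinD !prbE//; last exact: measurableU.
exact: measureU2.
Qed.

Lemma prbU A B : measurable A -> measurable B -> A `&` B = set0 ->
  prb (A `|` B) = prb A + prb B.
Proof.
move=> mA mB AB; apply: EFin_inj; rewrite EFinD !prbE//; last exact: measurableU.
exact: measureU.
Qed.

Definition finvar (F : finType) (X : T -> F) :=
  forall a, measurable (X @^-1` [set a]).

Definition law (F : finType) (X : T -> F) (a : F) : R := prb (X @^-1` [set a]).

Definition entropy (F : finType) (X : T -> F) : R :=
  \sum_a - (law X a * ln (law X a)).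

Lemma finvar_cons (F : eqType) (X : T -> F) a s :
  [set x | X x \in a :: s] = X @^-1` [set a] `|` [set x | X x \in s].
Proof.
apply/seteqP; split => x /=; rewrite inE; first by move=> /orP[/eqP|]; [left|right].
by move=> [->|->]; rewrite ?eqxx ?orbT.
Qed.

Lemma finvar_mem (F : finType) (X : T -> F) (s : seq F) : finvar X ->
  measurable [set x | X x \in s].
Proof.
move=> mX; elim: s => [|a s IH]; last by rewrite finvar_cons; exact: measurableU.
by rewrite (_ : mkset _ = set0)//; apply/seteqP; split.
Qed.

Lemma mem_enum_pred (F : finType) (X : T -> F) (P : pred F) :
  [set x | X x \in enum P] = [set x | P (X x)].
Proof. by apply/seteqP; split => x /=; rewrite mem_enum. Qed.

Lemma finvar_pred (F : finType) (X : T -> F) (P : pred F) : finvar X ->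
  measurable [set x | P (X x)].
Proof. by move=> mX; rewrite -mem_enum_pred; exact: finvar_mem. Qed.

Lemma prb_pred (F : finType) (X : T -> F) (P : pred F) : finvar X ->
  prb [set x | P (X x)] = \sum_(a | P a) law X a.
Proof.
move=> mX; rewrite -mem_enum_pred -[RHS]big_enum.
elim: (enum P) (enum_uniq P) => [|a s IH] /=.
  by rewrite big_nil (_ : mkset _ = set0) ?prb0//; apply/seteqP; split.
move=> /andP[as_ us]; rewrite big_cons finvar_cons prbU ?IH//; first exact: finvar_mem.
by apply/seteqP; split => x //= [->]; rewrite (negPf as_).
Qed.

Lemma law_ge0 (F : finType) (X : T -> F) a : 0 <= law X a. Proof. exact: prb_ge0. Qed.

Lemma sum_law (F : finType) (X : T -> F) : finvar X -> \sum_a law X a = 1.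
Proof.
move=> mX; rewrite -(prb_pred predT mX) (_ : mkset _ = setT) ?prbT//.
by apply/seteqP; split.
Qed.

Lemma preimage_comp_pred (F G : finType) (X : T -> F) (g : F -> G) b :
  (g \o X) @^-1` [set b] = [set x | g (X x) == b].
Proof. by apply/seteqP; split => x /= /eqP. Qed.

Lemma finvar_comp (F G : finType) (X : T -> F) (g : F -> G) :
  finvar X -> finvar (g \o X).
Proof.
by move=> mX b; rewrite preimage_comp_pred; exact: (finvar_pred (fun a => g a == b)).
Qed.

Lemma law_comp (F G : finType) (X : T -> F) (g : F -> G) b : finvar X ->
  law (g \o X) b = \sum_(a | g a == b) law X a.
Proof.
by move=> mX; rewrite /law preimage_comp_pred (prb_pred (fun a => g a == b)).
Qed.

Lemma finvar_pair (F G : finType) (X : T -> F) (Y : T -> G) :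
  finvar X -> finvar Y -> finvar (fun x => (X x, Y x)).
Proof.
move=> mX mY [a b]; rewrite (_ : _ @^-1` _ = (X @^-1` [set a]) `&` (Y @^-1` [set b])).
  exact: measurableI.
by apply/seteqP; split => x /= [-> ->].
Qed.

(** This is ln t <= t - 1 at t = q / law, summed over the values of positive probability. A
    subprobability [q] suffices, so explicit weights can be used without exact normalization. *)
Lemma gibbs (F : finType) (X : T -> F) (q : F -> R) : finvar X ->
  (forall a, 0 <= q a) -> \sum_a q a <= 1 -> (forall a, 0 < law X a -> 0 < q a) ->
  entropy X <= \sum_a - (law X a * ln (q a)).
Proof.
move=> mX q0 q1 qX; rewrite -subr_le0 -sumrB.
apply: (@le_trans _ _ (\sum_a (q a - law X a))); last first.
  by rewrite sumrB sum_law// subr_le0.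
apply: ler_sum => a _; have [l0|l0] := ltP 0 (law X a); last first.
  have -> : law X a = 0 by apply: le_anti; rewrite l0 law_ge0.
  by rewrite !mul0r subr0 oppr0 subr0.
have qa := qX _ l0.
rewrite opprK addrC -mulrBr -ln_div ?posrE//.
have := @le_ln1Dx R (q a / law X a - 1); rewrite [1 + _]addrC subrK => /(_ _)/wrap[].
  by rewrite ltrBrDl subrr divr_gt0.
move=> h; apply: le_trans (ler_wpM2l (ltW l0) h) _.
by rewrite mulrBr mulr1 mulrC divfK// gt_eqF.
Qed.

(** Merging values increases each probability inside the logarithm. *)
Lemma entropy_comp (F G : finType) (X : T -> F) (g : F -> G) : finvar X ->
  entropy (g \o X) <= entropy X.
Proof.
move=> mX; rewrite /entropy [leRHS](partition_big g predT) //=.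
apply: ler_sum => b _; rewrite law_comp// mulr_suml -sumrN.
apply: ler_sum => a /eqP gab; rewrite lerN2.
have := law_ge0 X a; rewrite le_eqVlt => /predU1P[<-|l0]; first by rewrite !mul0r.
rewrite ler_wpM2l ?(ltW l0)// ler_ln ?posrE//.
  by rewrite (bigD1 a) ?gab//= lerDl sumr_ge0// => i _; exact: law_ge0.
by rewrite (lt_le_trans l0)// (bigD1 a) ?gab//= lerDl sumr_ge0// => i _; exact: law_ge0.
Qed.

(** Gibbs' inequality against the product of the marginal laws. *)
Lemma entropy_pair (F G : finType) (X : T -> F) (Y : T -> G) :
  finvar X -> finvar Y -> entropy (fun x => (X x, Y x)) <= entropy X + entropy Y.
Proof.
move=> mX mY; have mXY := finvar_pair mX mY; set Z := fun x => _ in mXY *.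
have lX a : law X a = \sum_b law Z (a, b).
  rewrite -[X in law X]/(fst \o Z) law_comp//.
  rewrite (reindex_onto (fun b => (a, b)) snd) /=; last by move=> [c e] /= /eqP ->.
  by apply: eq_bigl => b; rewrite !eqxx.
have lY b : law Y b = \sum_a law Z (a, b).
  rewrite -[X in law X]/(snd \o Z) law_comp//.
  rewrite (reindex_onto (fun a => (a, b)) fst) /=; last by move=> [c e] /= /eqP ->.
  by apply: eq_bigl => a; rewrite !eqxx.
have lZX a b : law Z (a, b) <= law X a.
  by rewrite lX (bigD1 b)//= lerDl sumr_ge0// => i _; exact: law_ge0.
have lZY a b : law Z (a, b) <= law Y b.
  by rewrite lY (bigD1 a)//= lerDl sumr_ge0// => i _; exact: law_ge0.
apply: le_trans (@gibbs _ Z (fun p => law X p.1 * law Y p.2) mXY _ _ _) _.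
- by move=> p; rewrite mulr_ge0 ?law_ge0.
- rewrite -(pair_bigA _ (fun a b => law X a * law Y b)) /=.
  by under eq_bigr do rewrite -mulr_sumr sum_law// mulr1; rewrite sum_law.
- by move=> [a b] l0; rewrite mulr_gt0 ?(lt_le_trans l0).
rewrite (eq_bigr (fun p => - (law Z (p.1, p.2) * ln (law X p.1 * law Y p.2)))); last by case.
rewrite -(pair_bigA _ (fun a b => - (law Z (a, b) * ln (law X a * law Y b)))) /=.
have E a b : - (law Z (a, b) * ln (law X a * law Y b)) =
    - (law Z (a, b) * ln (law X a)) - law Z (a, b) * ln (law Y b).
  have := law_ge0 Z (a, b); rewrite le_eqVlt => /predU1P[<-|l0].
    by rewrite !mul0r oppr0 addr0.
  rewrite lnM ?posrE ?(lt_le_trans l0)// mulrDr opprD//.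
under eq_bigr do under eq_bigr do rewrite E.
under eq_bigr do rewrite big_split /=.
rewrite big_split /= /entropy lerD//.
  by apply: ler_sum => a _; rewrite {2}lX sumrN mulr_suml.
rewrite exchange_big /=; apply: ler_sum => b _.
by rewrite {2}lY sumrN mulr_suml.
Qed.

Variable f : T -> T.
Hypothesis mf : forall B, measurable B -> measurable (f @^-1` B).
Hypothesis inv_mu : invariant_measure mu f.

Definition joint (F : finType) (X : T -> F) n (x : T) : {ffun 'I_n -> F} :=
  [ffun i : 'I_n => X (iter i f x)].

Lemma iter_preimage i (B : set T) : measurable B ->
  measurable (iter i f @^-1` B) /\ mu (iter i f @^-1` B) = mu B.
Proof.
move=> mB; elim: i => [|i [mi e]] //.
rewrite (_ : iter i.+1 f @^-1` B = f @^-1` (iter i f @^-1` B)); last first.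
  by apply/seteqP; split => x /=; rewrite -iterS iterSr.
by split; [exact: mf|rewrite inv_mu].
Qed.

Lemma finvar_iter (F : finType) (X : T -> F) i : finvar X -> finvar (X \o iter i f).
Proof. by move=> mX a; rewrite comp_preimage; have [] := iter_preimage i (mX a). Qed.

Lemma entropy_iter (F : finType) (X : T -> F) i : finvar X ->
  entropy (X \o iter i f) = entropy X.
Proof.
move=> mX; apply: eq_bigr => a _; rewrite /law /prb comp_preimage.
by have [_ ->] := iter_preimage i (mX a).
Qed.

Lemma finvar_joint (F : finType) (X : T -> F) n : finvar X -> finvar (joint X n).
Proof.
move=> mX w; rewrite (_ : _ @^-1` _ =
    \big[setI/setT]_(i : 'I_n) ((X \o iter i f) @^-1` [set w i])).
  by apply: bigsetI_measurable => i _; exact: finvar_iter.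
rewrite -bigcap_seq; apply/seteqP; split => x /=.
  by move=> <- i _ /=; rewrite ffunE.
by move=> h; apply/ffunP => i; rewrite ffunE; apply: h; rewrite /= mem_index_enum.
Qed.

Lemma entropy_joint_le (F : finType) (X : T -> F) n : finvar X ->
  entropy (joint X n) <= n%:R * entropy X.
Proof.
move=> mX; elim: n => [|n IH].
  (* There is only one word of length 0, so the weight 1 is a probability and gives entropy at most
     0. *)
  have h := @gibbs _ (joint X 0) (fun=> 1) (@finvar_joint _ X 0 mX).
  apply: (le_trans (h _ _ _)) => //.
    by rewrite sumr_const card_ffun card_ord expn0.
  by rewrite big1 ?mul0r// => w _; rewrite ln1 mulr0 oppr0.
pose g (p : {ffun 'I_n -> F} * F) : {ffun 'I_n.+1 -> F} :=
  [ffun i => if unlift ord_max i is Some j then p.1 j else p.2].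
have -> : joint X n.+1 = g \o (fun x => (joint X n x, (X \o iter n f) x)).
  apply/funext => x; apply/ffunP => i; rewrite /g /= !ffunE.
  case: unliftP => [j ->|->] /=; rewrite ?ffunE//.
  by have := lift_max j; rewrite /= => ->.
have mJ := @finvar_joint _ _ n mX; have mI := @finvar_iter _ _ n mX.
apply: (le_trans (entropy_comp g (finvar_pair mJ mI))).
apply: (le_trans (entropy_pair mJ mI)).
by rewrite entropy_iter// -natr1 mulrDl mul1r lerD2r.
Qed.

End FiniteRandomVariables.

(** * Generating partitions *)

Lemma ltn_addord n N (i : 'I_n) (j : 'I_N) : (i + j < n + N)%N.
Proof. by rewrite -addnS leq_add // ltnW. Qed.

Lemma sum_option (V : nmodType) (I : finType) (F : option I -> V) :
  \sum_o F o = F None + \sum_i F (Some i).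
Proof.
rewrite (bigD1 None) //=; congr (_ + _).
rewrite (reindex_omap Some id) /=; last by case.
by apply: eq_bigl => i; rewrite eqxx.
Qed.

Section Generator.
Context {R : realType} {d : measure_display} {T : measurableType d}.
Variables (mu : probability T R) (f : T -> T).
Hypothesis mf : forall B, measurable B -> measurable (f @^-1` B).
Hypothesis inv_mu : invariant_measure mu f.
Variables (L : finType) (lab : T -> L).
Hypothesis mlab : finvar lab.

Definition cylinder_union N (A : pred {ffun 'I_N -> L}) : set T :=
  [set x | A (joint f lab N x)].

Lemma measurable_cylinder_union N (A : pred {ffun 'I_N -> L}) :
  measurable (cylinder_union A).
Proof. exact: (finvar_pred A (finvar_joint mf inv_mu mlab)). Qed.

Lemma cylinder_union_widen N M (A : pred {ffun 'I_N -> L}) : (N <= M)%N ->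
  exists A' : pred {ffun 'I_M -> L}, cylinder_union A' = cylinder_union A.
Proof.
move=> NM; exists (fun w => A [ffun i => w (widen_ord NM i)]).
rewrite /cylinder_union; apply/seteqP; split => x /=;
  by congr (is_true (A _)); apply/ffunP => i; rewrite !ffunE.
Qed.

Definition approximable (B : set T) := measurable B /\ forall e : R, 0 < e ->
  exists N (A : pred {ffun 'I_N -> L}),
    prb mu (B `\` cylinder_union A) < e /\ prb mu (cylinder_union A `\` B) < e.

Lemma approximable_cylinder N (A : pred {ffun 'I_N -> L}) :
  approximable (cylinder_union A).
Proof.
split; first exact: measurable_cylinder_union.
by move=> e e0; exists N, A; rewrite setDv prb0.
Qed.

Lemma approximableC B : approximable B -> approximable (~` B).
Proof.
move=> [mB aB]; split; first exact: measurableC.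
move=> e /aB[N [A [h1 h2]]]; exists N, (predC A).
have -> : cylinder_union (predC A) = ~` cylinder_union A.
  by apply/seteqP; split => x /= /negP.
have sw (U V : set T) : ~` U `\` ~` V = V `\` U by rewrite !setDE setCK setIC.
by rewrite !sw.
Qed.

Lemma approximableU B C : approximable B -> approximable C -> approximable (B `|` C).
Proof.
move=> [mB aB] [mC aC]; split; first exact: measurableU.
move=> e e0; have e2 : 0 < e / 2 by rewrite divr_gt0.
have [N [A [a1 a2]]] := aB _ e2; have [M [D [d1 d2]]] := aC _ e2.
have [A' eA] := cylinder_union_widen A (leq_maxl N M).
have [D' eD] := cylinder_union_widen D (leq_maxr N M).
exists (maxn N M), (predU A' D').
have -> : cylinder_union (predU A' D') = cylinder_union A `|` cylinder_union D.
  by rewrite -eA -eD; apply/seteqP; split => x /= /orP.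
have mA := measurable_cylinder_union A; have mD := measurable_cylinder_union D.
move: (cylinder_union A) (cylinder_union D) mA mD a1 a2 d1 d2 => U V mU mV a1 a2 d1 d2.
have key (W W' Z Z' : set T) :
    measurable W -> measurable W' -> measurable Z -> measurable Z' ->
    prb mu (W `\` Z) < e / 2 -> prb mu (W' `\` Z') < e / 2 ->
    prb mu ((W `|` W') `\` (Z `|` Z')) < e.
  move=> mW mW' mZ mZ' h h'.
  have m1 := measurableD mW mZ; have m2 := measurableD mW' mZ'.
  apply: (@le_lt_trans _ _ (prb mu ((W `\` Z) `|` (W' `\` Z')))).
    apply: le_prb; [apply: measurableD; exact: measurableU|exact: measurableU|].
    by move=> x [[Wx|Wx] /not_orP[nZ nZ']]; [left|right].
  by apply: (le_lt_trans (prbU_le mu m1 m2)); rewrite (splitr e) ltrD.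
by split; apply: key.
Qed.

(** Continuity of the measure from below replaces the union by a finite one at the cost of e / 2. *)
Lemma approximable_bigcup (B : (set T)^nat) : (forall n, approximable (B n)) ->
  approximable (\bigcup_n B n).
Proof.
move=> aB; have mB n : measurable (B n) by case: (aB n).
have mU : measurable (\bigcup_n B n) by exact: bigcupT_measurable.
split => // e e0; have e2 : 0 < e / 2 by rewrite divr_gt0.
pose F n := \big[setU/set0]_(i < n) B i.
have mF n : measurable (F n) by exact: bigsetU_measurable.
have aF n : approximable (F n).
  rewrite /F; elim/big_ind: _ => // [|A C]; last exact: approximableU.
  rewrite (_ : set0 = cylinder_union (N := 0) pred0); first exact: approximable_cylinder.
  by apply/seteqP; split.
have UF : \bigcup_n F n = \bigcup_n B n.
  apply/seteqP; split => x [n _].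
    by rewrite /F -bigcup_mkord => -[i /= _ Bi]; exists i.
  by move=> Bn; exists n.+1 => //; rewrite /F -bigcup_mkord; exists n => /=.
have ndF : nondecreasing_seq F.
  move=> n m nm; apply/subsetPset; rewrite /F -!bigcup_mkord => x [i /= ni Bi].
  by exists i => //=; exact: leq_trans nm.
have cv : prb mu (F n) @[n --> \oo] --> prb mu (\bigcup_n B n).
  have := @nondecreasing_cvg_mu _ _ _ mu F mF; rewrite UF => /(_ mU ndF).
  by move=> h; apply: (@fine_cvg _ _ _ _ (mu \o F)); rewrite prbE.
have [n hn] : exists n, prb mu (\bigcup_n B n) - prb mu (F n) < e / 2.
  have /cvgrPdist_lt /(_ _ e2) [n _ hn] := cv.
  by exists n; apply: le_lt_trans (hn n (leqnn n)); exact: ler_norm.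
have [N [A [h1 h2]]] := (aF n).2 _ e2.
have mA := measurable_cylinder_union A.
have FB : F n `<=` \bigcup_n B n by rewrite -UF => x Fx; exists n.
exists N, A; split; last first.
  apply: le_lt_trans (lt_trans h2 _); last by lra.
  apply: le_prb; [exact: measurableD|exact: measurableD|].
  by move=> x [Ax nB]; split => // /FB.
have mD : measurable ((\bigcup_n B n) `\` F n) by exact: measurableD.
apply: (@le_lt_trans _ _ (prb mu (((\bigcup_n B n) `\` F n) `|` (F n `\` cylinder_union A)))).
  apply: le_prb; [exact: measurableD|apply: measurableU => //; exact: measurableD|].
  by move=> x [Bx nA]; have [Fx|nF] := pselect (F n x); [right|left].
apply: (le_lt_trans (prbU_le mu mD _)); first exact: measurableD.
rewrite (splitr e) ltrD//; apply: le_lt_trans hn.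
have := @prbU _ _ _ mu _ _ (mF n) mD.
have -> : F n `|` ((\bigcup_n B n) `\` F n) = \bigcup_n B n.
  apply/seteqP; split => x; first by move=> [/FB//|[]].
  by move=> Bx; have [Fx|nF] := pselect (F n x); [left|right].
move=> -> ; first by rewrite addrAC subrr add0r.
by apply/seteqP; split => x // [? []].
Qed.

(** Approximable sets form a sigma-algebra, and each [U] in [G] belongs to it as the countable union
    of the cylinders contained in [U]. *)
Lemma approximable_generated (G : set (set T)) :
  (@measurable _ T) = <<s G >> ->
  (forall U x, G U -> U x -> exists N,
     forall y, joint f lab N y = joint f lab N x -> U y) ->
  forall B, measurable B -> approximable B.
Proof.
move=> eG sepG B; rewrite eG => /(_ approximable); apply; split.
  split.
  - rewrite (_ : set0 = cylinder_union (N := 0) pred0); first exact: approximable_cylinder.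
    by apply/seteqP; split.
  - by move=> A aA; rewrite setTD; exact: approximableC.
  - exact: approximable_bigcup.
move=> U GU.
pose A N : pred {ffun 'I_N -> L} := fun w => `[< forall y, joint f lab N y = w -> U y >].
rewrite (_ : U = \bigcup_N cylinder_union (@A N)).
  by apply: approximable_bigcup => N; exact: approximable_cylinder.
apply/seteqP; split => x.
  by move=> /(sepG _ _ GU)[N hN]; exists N => //; apply/asboolP.
by move=> [N _ /asboolP]; exact.
Qed.

Hypothesis gen : forall B, measurable B -> approximable B.

Lemma approximable_family (I : finType) (B : I -> set T) : (forall i, measurable (B i)) ->
  forall e : R, 0 < e -> exists N (A : I -> pred {ffun 'I_N -> L}), forall i,
    prb mu (B i `\` cylinder_union (A i)) < e /\ prb mu (cylinder_union (A i) `\` B i) < e.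
Proof.
move=> mB e e0.
have h i : {N : nat & {A : pred {ffun 'I_N -> L} |
    prb mu (B i `\` cylinder_union A) < e /\ prb mu (cylinder_union A `\` B i) < e}}.
  have [_ /(_ _ e0) h] := gen (mB i).
  by have [N /cid hN] := cid h; exists N.
pose M := \max_i projT1 (h i).
have w i : exists A' : pred {ffun 'I_M -> L},
    cylinder_union A' = cylinder_union (projT1 (projT2 (h i))).
  by apply: cylinder_union_widen; exact: leq_bigmax.
exists M, (fun i => projT1 (cid (w i))) => i.
by case: (cid (w i)) => A' /= ->; case: (projT2 (h i)).
Qed.

Lemma finvar_option k (xi : T -> 'I_k) : finvar xi -> forall N
  (phi : {ffun 'I_N -> L} -> option 'I_k),
  finvar (fun x => if phi (joint f lab N x) == Some (xi x) then None else Some (xi x)).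
Proof.
move=> mxi N phi.
have mp := finvar_pair (finvar_joint (n := N) mf inv_mu mlab) mxi.
pose g (p : {ffun 'I_N -> L} * 'I_k) : option 'I_k :=
  if phi p.1 == Some p.2 then None else Some p.2.
exact: (finvar_comp g mp).
Qed.

(** A variable that is almost always [None] has small entropy: Gibbs' inequality against mass 1 - q
    at [None] and q spread over the other values. *)
Lemma entropy_correction k (tol : R) : 0 < tol -> exists2 e : R, 0 < e &
  forall E : T -> option 'I_k, finvar E ->
    \sum_(i : 'I_k) law mu E (Some i) < e -> entropy mu E <= tol.
Proof.
(* The value [None] contributes at most - ln (1 - q) <= 2q <= tol / 2, the first inequality using q
   <= 1/2; the threshold e bounds the other values by tol / 2. Dividing by [k.+1] allows k = 0. *)
move=> t0; pose q := Num.min (1 / 2) (tol / 4).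
have q0 : 0 < q by rewrite lt_min !divr_gt0.
have q1 : q <= 1 / 2 by rewrite ge_min lexx.
have q2 : q <= tol / 4 by rewrite ge_min lexx orbT.
have qk : 0 < q / k.+1%:R by rewrite divr_gt0.
have lk : 0 < - ln (q / k.+1%:R).
  rewrite oppr_gt0 ln_lt0// qk ltr_pdivrMr//= mul1r.
  by apply: (@lt_le_trans _ _ 1); [lra|rewrite ler1n].
exists (tol / 2 / - ln (q / k.+1%:R)); first by rewrite !divr_gt0.
move=> E mE sE.
pose Q (o : option 'I_k) := if o is Some _ then q / k.+1%:R else 1 - q.
have Q0 o : 0 < Q o by case: o => //=; lra.
have h := @gibbs _ _ _ mu _ E Q mE (fun o => ltW (Q0 o)).
apply: (le_trans (h _ _)) => // {h}.
  rewrite sum_option /= sumr_const card_ord -[_ *+ k]mulr_natr.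
  rewrite -[leRHS](subrK q) lerD2l -mulrA ler_piMr ?(ltW q0)//.
  by rewrite ler_pdivrMl// mulr1 ler_nat.
rewrite sum_option /= -mulrN.
under eq_bigr do rewrite -mulrN.
rewrite -mulr_suml (splitr tol) lerD//.
  have l1 : law mu E None <= 1.
    by rewrite -(sum_law mu mE) (bigD1 None)//= lerDl sumr_ge0// => i _; exact: law_ge0.
  have : - ln (1 - q) <= 2 * q.
    rewrite -lnV ?posrE; last by lra.
    have := @le_ln1Dx R ((1 - q)^-1 - 1); rewrite subrKC.
    have e1 : (1 - q)^-1 - 1 = q / (1 - q) by field; lra.
    have e2 : q / (1 - q) <= 2 * q by rewrite ler_pdivrMr; nra.
    have e3 : 0 <= q / (1 - q) by rewrite divr_ge0; lra.
    by move=> /(_ ltac:(lra)); lra.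
  have := law_ge0 mu E None; nra.
by apply/ltW; rewrite -ltr_pdivlMr.
Qed.

Lemma join_entropyE k (xi : T -> 'I_k) n : join_entropy mu f xi n = entropy mu (joint f xi n).
Proof.
apply: eq_bigr => w _; rewrite /law /prb.
suff -> : cell f xi w = joint f xi n @^-1` [set w] by [].
apply/seteqP; split => x /=; first by move=> h; apply/ffunP => i; rewrite ffunE.
by move=> <- i; rewrite ffunE.
Qed.

(** Up to a rare error, [xi] is predicted by the first N labels. The n-th join of [xi] is thus a
    function of n + N labels and of the n-th join of a correction variable, whose entropy is at most
    [n%:R * tol]. *)
Lemma join_entropy_le k (xi : T -> 'I_k) (tol : R) : finvar xi -> 0 < tol ->
  exists N, forall n, join_entropy mu f xi n <=
    entropy mu (joint f lab (n + N)) + n%:R * tol.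
Proof.
move=> mxi t0; have [e e0 he] := entropy_correction k t0.
have k0 : (0 < k)%N by case: k xi {mxi he} => // xi; case: (xi point).
have ek : 0 < e / 2 / k%:R by rewrite !divr_gt0 ?ltr0n.
have [N [A hA]] := approximable_family (fun i => mxi i) ek.
exists N => n.
(* Off the error sets [B i], exactly one [A i] holds and it names the cell of [xi]; [E] records the
   true cell whenever the prediction fails. *)
pose phi (w : {ffun 'I_N -> L}) : option 'I_k := [pick i | A i w].
pose E x := if phi (joint f lab N x) == Some (xi x) then None else Some (xi x).
have mE : finvar E by exact: finvar_option.
pose B i : set T := ((xi @^-1` [set i]) `\` cylinder_union (A i))
  `|` (cylinder_union (A i) `\` (xi @^-1` [set i])).
have mB i : measurable (B i).
  by apply: measurableU; apply: measurableD => //; exact: measurable_cylinder_union.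
have hB i : prb mu (B i) < e / k%:R.
  have m1 : measurable ((xi @^-1` [set i]) `\` cylinder_union (A i)).
    by apply: measurableD => //; exact: measurable_cylinder_union.
  have m2 : measurable (cylinder_union (A i) `\` (xi @^-1` [set i])).
    by apply: measurableD => //; exact: measurable_cylinder_union.
  apply: (le_lt_trans (prbU_le mu m1 m2)); have [h1 h2] := hA i.
  by have := ltrD h1 h2; congr (_ < _); field; rewrite pnatr_eq0 -lt0n.
have EB x : E x != None -> exists i, B i x.
  apply: contraNP => /forallNP nB; rewrite /E.
  suff -> : phi (joint f lab N x) = Some (xi x) by rewrite eqxx.
  have h i : A i (joint f lab N x) = (xi x == i).
    apply/idP/eqP => [Ai|xii].
      by apply: contrapT => ne; apply: (nB i); right.
    by apply: contrapT => ne; apply: (nB i); left.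
  rewrite /phi; case: pickP => [i|/(_ (xi x))]; last by rewrite h eqxx.
  by rewrite h => /eqP ->.
have HE : entropy mu E <= tol.
  apply: he => //.
  rewrite (_ : \sum_i _ = prb mu [set x | E x != None]); last first.
    rewrite (prb_pred mu (fun o => o != None) mE) [RHS]big_mkcond sum_option /= add0r.
    by apply: eq_bigr.
  apply: (@le_lt_trans _ _ (prb mu (\big[setU/set0]_(i : 'I_k) B i))).
    apply: le_prb; [exact: (finvar_pred (fun o => o != None) mE)|exact: bigsetU_measurable|].
    by move=> x /EB[i Bi]; rewrite -bigcup_seq; exists i => //=; rewrite mem_index_enum.
  have sub (s : seq 'I_k) : prb mu (\big[setU/set0]_(i <- s) B i) <=
      \sum_(i <- s) prb mu (B i).
    elim: s => [|i s IH]; first by rewrite !big_nil prb0.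
    rewrite !big_cons; apply: (le_trans (prbU_le mu _ _)) => //; last by rewrite lerD2l.
    exact: bigsetU_measurable.
  apply: (le_lt_trans (sub _)).
  have -> : e = \sum_(i : 'I_k) e / k%:R.
    by rewrite sumr_const card_ord -[(e / _) *+ _]mulr_natr divfK// pnatr_eq0 -lt0n.
  have [i0 _] : exists i : 'I_k, true by exists (xi point).
  apply: ltr_sum => //; apply/hasP; exists i0; rewrite ?mem_index_enum//.
pose x0 := xi point.
(* The default [x0] is never reached on actual orbits: [E] is [None] only where [phi] returns the
   correct cell. *)
pose g (p : {ffun 'I_(n + N) -> L} * {ffun 'I_n -> option 'I_k}) : {ffun 'I_n -> 'I_k} :=
  [ffun i => if p.2 i is Some j then j else
     odflt x0 (phi [ffun j : 'I_N => p.1 (Ordinal (ltn_addord i j))])].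
have mW : finvar (joint f lab (n + N)) := finvar_joint mf inv_mu mlab.
have mJ : finvar (joint f E n) := finvar_joint mf inv_mu mE.
rewrite join_entropyE.
have -> : joint f xi n = g \o (fun x => (joint f lab (n + N) x, joint f E n x)).
  apply/funext => x; apply/ffunP => i; rewrite /g /= !ffunE /E.
  have -> : [ffun j : 'I_N => joint f lab (n + N) x (Ordinal (ltn_addord i j))] =
      joint f lab N (iter i f x).
    by apply/ffunP => j; rewrite !ffunE /= addnC iterD.
  by case: eqP => [->|].
apply: (le_trans (entropy_comp mu g (finvar_pair mW mJ))).
apply: (le_trans (entropy_pair mu mW mJ)); rewrite lerD2l.
apply: (le_trans (entropy_joint_le mf inv_mu n mE)).
by rewrite ler_wpM2l.
Qed.

End Generator.

(** * Hausdorff dimension and word sums *)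

Section HausdorffCover.
Variables (R : realType) (T : metricType R).
Local Open Scope ereal_scope.

Lemma diam_le (U : set T) (r : R) : (0 <= r)%R ->
  (forall x y, U x -> U y -> (mdist x y <= r)%R) -> diam U <= r%:E.
Proof.
move=> r0 h; rewrite /diam ge_max lee_fin r0 /=.
by apply: ge_ereal_sup => _ [[x y] /= [Ux Uy] <-]; rewrite lee_fin h.
Qed.

Lemma diam_set0 : diam (set0 : set T) = 0.
Proof.
by apply/le_anti; rewrite diam_le //= /diam le_max lexx.
Qed.

(** Covers indexed by words become sequences through [pickle_inv]; integers coding no word get the
    empty set, which costs 0 because s > 0. Bounds on finite subfamilies control the series of
    nonnegative terms. *)
Lemma hausdorff_measure_eq0 (W : countType) (s : R) (Y : set T) : (0 < s)%R ->
  (forall delta e : R, (0 < delta)%R -> (0 < e)%R ->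
    exists (C : W -> set T) (a : W -> R),
      [/\ Y `<=` \bigcup_w C w, forall w, diam (C w) <= delta%:E,
          forall w, diam (C w) `^ s <= (a w)%:E &
          forall l : seq W, uniq l -> (\sum_(w <- l) a w <= e)%R]) ->
  hausdorff_measure s Y = 0.
Proof.
move=> s0 small; apply/eqP; rewrite eq_le; apply/andP; split; last first.
  apply: (@le_trans _ _ (hausdorff_premeasure s 1 Y)).
    apply: le_ereal_inf_tmp => _ [U _ <-].
    by apply: nneseries_ge0 => k _ _; exact: poweR_ge0.
  by apply: ereal_sup_ubound; exists 1%R => //=; exact: ltr01.
apply: ge_ereal_sup => _ [delta /= delta0 <-].
apply/lee_addgt0Pr => e e0; rewrite add0e.
have [C [a [YC dC sC aC]]] := small _ _ delta0 e0.
pose U k := oapp C set0 (pickle_inv (T := W) k).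
have dU k : diam (U k) <= delta%:E.
  by rewrite /U; case: pickle_inv => //=; rewrite diam_set0 lee_fin ltW.
apply: (@le_trans _ _ (\sum_(0 <= k <oo) (diam (U k)) `^ s)).
  apply: ereal_inf_lbound; exists U => //; split => // y /YC[w _ Cw].
  by exists (pickle w) => //; rewrite /U pickleK_inv.
apply: lime_le; first by apply: is_cvg_nneseries => k _ _; exact: poweR_ge0.
apply: nearW => m.
pose l := pmap (pickle_inv (T := W)) (index_iota 0 m).
have ul : uniq l.
  by rewrite (pmap_uniq (@pickle_invK W))// iota_uniq.
apply: (@le_trans _ _ (\sum_(w <- l) (a w)%:E)).
  rewrite /l; elim: (index_iota 0 m) => [|k r IH] /=; first by rewrite !big_nil.
  rewrite big_cons {1}/U; case: pickle_inv => [w|] /=.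
    by rewrite big_cons; exact: leeD.
  by rewrite diam_set0 poweR0r ?add0e// gt_eqF.
by rewrite sumEFin lee_fin; exact: aC.
Qed.

End HausdorffCover.

(** A duplicate-free list of words is sorted by length, each length contributing at most the full
    sum over that level. *)
Lemma sum_uniq_words (R : realType) (L : finType) (a : seq L -> R) (b : nat -> R) :
  (forall w, 0 <= a w) -> (forall n, \sum_(t : n.-tuple L) a t <= b n) ->
  forall l : seq (seq L), uniq l -> exists M, \sum_(w <- l) a w <= \sum_(n < M) b n.
Proof.
move=> a0 ab l ul; exists (\max_(w <- l) size w).+1.
set M := _.+1.
apply: (@le_trans _ _ (\sum_(w <- l) \sum_(n < M) \sum_(t : n.-tuple L)
    if w == t then a t else 0)).
  rewrite big_seq [leRHS]big_seq; apply: ler_sum => w wl.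
  have wM : (size w < M)%N by rewrite ltnS; apply: leq_bigmax_seq.
  rewrite (bigD1 (Ordinal wM)) //= (bigD1 (in_tuple w)) //= eqxx -addrA lerDl.
  rewrite addr_ge0 ?sumr_ge0 // => [t _|n _]; first by case: ifP.
  by apply: sumr_ge0 => t _; case: ifP.
rewrite exchange_big /=; apply: ler_sum => n _; apply: le_trans (ab n).
rewrite exchange_big /=; apply: ler_sum => t _.
have [tl|tl] := boolP (tval t \in l).
  rewrite (bigD1_seq (tval t)) //= eqxx big1 ?addr0// => w /negPf -> //.
by rewrite big_seq big1// => w wl; case: eqP => // e; rewrite -e wl in tl.
Qed.

Lemma sum_geometric_tail (R : realType) (rho : R) (N M : nat) : 0 < rho -> rho < 1 ->
  \sum_(n < M) (if (N <= n)%N then rho ^+ n else 0) <= rho ^+ N / (1 - rho).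
Proof.
move=> r0 r1; rewrite ler_pdivlMr ?subr_gt0//.
(* The added remainder, rho to the power max(N, M), makes the sum telescope in the induction on
   M. *)
suff : (\sum_(n < M) (if (N <= n)%N then rho ^+ n else 0)) * (1 - rho)
    + (if (N <= M)%N then rho ^+ M else rho ^+ N) <= rho ^+ N.
  apply: le_trans; rewrite lerDl; case: ifP => _; exact: exprn_ge0 (ltW r0).
elim: M => [|M IH].
  by rewrite big_ord0 mul0r add0r; case: ifP => //; rewrite leqn0 => /eqP ->.
rewrite big_ord_recr /= mulrDl; apply: le_trans IH; rewrite -addrA lerD2l.
have [NM|MN] := leqP N M; first by rewrite leqW// exprS; lra.
have [NM|//] := leqP N M.+1; last by rewrite mul0r add0r.
by have -> : N = M.+1 by [apply/eqP; rewrite eqn_leq NM MN]; rewrite mul0r add0r.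
Qed.

(** * Weights of words and sums over admissible words *)

Section WordWeights.
Variable R : realType.
Implicit Types (w : seq label).

Definition wden w : R :=
  if w is l :: s then denom (weights l (1, 2) s) else 1.

Lemma le12 : 1 <= 2 :> R. Proof. by rewrite ler1n. Qed.

Lemma wden_ge w : (size w)%:R <= wden w.
Proof.
case: w => [|l s] /=; first exact: ler01.
have [_ _ h] := @weights_ge1 R l (1, 2) s (lexx 1) le12.
by apply: le_trans h; rewrite /denom /= -natr1; lra.
Qed.

Lemma wden_ge1 w : 1 <= wden w.
Proof.
case: w => [|l s] //; apply: le_trans (wden_ge _); by rewrite ler1n.
Qed.

Lemma wden_gt0 w : 0 < wden w. Proof. exact: lt_le_trans (wden_ge1 w). Qed.

(** The factor 4 counts first letters; the remaining n - 1 letters give [c ^+ n.-1], at most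
    [c ^+ n] as c >= 1. *)
Lemma sum_sorted (P : seq label -> R) (c : R) (n : nat) : 0 <= c -> 1 <= c ->
  P [::] <= 4 ->
  (forall l m, \sum_(s : m.-tuple label | path allowed l s) P (l :: s) <= c ^+ m) ->
  \sum_(t : n.-tuple label | sorted allowed t) P t <= 4 * c ^+ n.
Proof.
move=> c0 c1 P0 Pl; case: n => [|n].
  rewrite (big_pred1 [tuple]) /= ?expr0 ?mulr1// => s.
  by rewrite tuple0 /=; apply/esym/eqP.
rewrite big_tuple_cons /=.
apply: (@le_trans _ _ (\sum_(l : label) c ^+ n)).
  by apply: ler_sum => l _; exact: Pl.
rewrite sumr_const card_prod card_bool -[_ *+ _]mulr_natl.
by rewrite ler_wpM2l// exprS ler_peMl// exprn_ge0.
Qed.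

Lemma sum_sorted_invsqrt n :
  \sum_(t : n.-tuple label | sorted allowed t) (Num.sqrt (wden t))^-1
    <= 4 * (12 / 7) ^+ n.
Proof.
apply: (@sum_sorted (fun w => (Num.sqrt (wden w))^-1)) => //=; try lra.
  by rewrite sqrtr1 invr1; lra.
move=> l m; apply: le_trans (@sum_invsqrt R m l (1, 2) (lexx 1) le12) _.
rewrite ler_piMr ?exprn_ge0//.
rewrite /invsqrt /denom /= mul1r invf_le1 ?sqrtr_gt0//.
by rewrite -[leLHS]sqrtr1 ler_sqrt// ler1n.
Qed.

Lemma sum_sorted_count n :
  \sum_(t : n.-tuple label | sorted allowed t) (1 : R) <= 4 * 3 ^+ n.
Proof.
apply: (@sum_sorted (fun=> 1)) => //; try lra.
by move=> l m; exact: sum_count.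
Qed.

End WordWeights.

Section Itineraries.
Variable R : realType.
Implicit Types (z w : circle R).

Lemma itinE n z : itin n z =
  [seq joint (@bowen_series R) (@quadrant R) n z i | i <- enum 'I_n].
Proof.
apply: (@eq_from_nth _ (quadrant z)).
  by rewrite [RHS]size_map size_enum_ord [LHS]size_map size_traject.
rewrite size_map size_traject => i ni; rewrite (nth_map z) ?size_traject// nth_traject//.
rewrite (nth_map (Ordinal ni)) ?size_enum_ord// ffunE.
by congr (quadrant (iter _ _ _)); rewrite nth_enum_ord.
Qed.

Lemma sorted_itin n z : sorted allowed (itin n z).
Proof.
case: n => // n; rewrite /itin /=; elim: n z => //= n IH z.
by rewrite allowed_quadrant; exact: IH.
Qed.

Lemma chord_wden n z w : (0 < n)%N -> itin n z = itin n w ->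
  chord z w <= 18 / wden R (itin n z).
Proof.
case: n => // n _ e; rewrite ler_pdivlMr; last exact: wden_gt0.
exact: (chord_itin e).
Qed.

(** Tuples form a finite type, so that [law] and [gibbs] apply to itineraries. *)
Definition itint n z : n.-tuple label :=
  [tuple joint (@bowen_series R) (@quadrant R) n z i | i < n].

Lemma val_itint n z : itint n z = itin n z :> seq label.
Proof. by rewrite itinE. Qed.

End Itineraries.

(** * The measure of maximal entropy *)

Section MaximalEntropy.
Variables (R : realType) (nu : probability (circle R) R).
Hypothesis inv_nu : invariant_measure nu (@bowen_series R).

Let f := @bowen_series R.
Let mf := @measurable_bowen_series R.

Lemma finvar_quadrant : finvar (@quadrant R).
Proof. exact: measurable_quadrant. Qed.

Lemma finvar_itint n : finvar (@itint R n).
Proof.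
have mj := finvar_joint (n := n) mf inv_nu finvar_quadrant.
exact: (finvar_comp (fun w : {ffun 'I_n -> label} => [tuple w i | i < n]) mj).
Qed.

(** Points sharing N labels are within 18 / N of each other, so an open set contains a whole
    cylinder around each of its points. *)
Lemma quadrant_generates (B : set (circle R)) : measurable B ->
  approximable nu f (@quadrant R) B.
Proof.
apply: (approximable_generated mf inv_nu finvar_quadrant (G := @open (circle R))) => //.
move=> U z /circle_openP oU Uz; have [e e0 eU] := oU z Uz.
pose N := (Num.truncn (18 / e)).+1; exists N => w jw; apply: eU.
have ew : itin N z = itin N w by rewrite !itinE jw.
apply: le_lt_trans (chord_wden _ ew) _ => //.
have hN : 18 / e < N%:R by exact: truncnS_gt.
rewrite ltr_pdivrMr ?wden_gt0// mulrC -ltr_pdivrMr//.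
apply: lt_le_trans hN _.
have := wden_ge R (itin N z); by rewrite size_map size_traject.
Qed.

Definition bad n : set (circle R) := [set z | wden R (itin n z) < 3 ^+ n].

Lemma badE n : bad n = [set z | wden R (itint n z) < 3 ^+ n].
Proof. by apply/seteqP; split => z; rewrite /bad /= val_itint. Qed.

Lemma measurable_bad n : measurable (bad n).
Proof.
rewrite badE.
exact: (finvar_pred (fun t : n.-tuple label => wden R t < 3 ^+ n) (finvar_itint (n := n))).
Qed.

(** The exponential rate at which bad words are rarer than all words: each has wden^(-1/2) >
    3^(-n/2), so there are at most 4 (12/7)^n 3^(n/2) = 4 * 3^n exp(- n gap) of them. *)
Definition gap : R := ln 3 / 2 - ln (12 / 7).

Lemma gap_gt0 : 0 < gap.
Proof.
have h : ln ((12 / 7) ^+ 2) < ln 3 :> R.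
  by rewrite ltr_ln ?posrE// expr2; lra.
move: h; rewrite lnXn; last by lra.
rewrite /gap -mulr_natr => h; lra.
Qed.

Lemma ln_sqrt (x : R) : 0 < x -> ln (Num.sqrt x) = ln x / 2.
Proof.
move=> x0; rewrite -{2}(sqr_sqrtr (ltW x0)) lnXn ?sqrtr_gt0//.
by rewrite -[_ *+ 2]mulr_natr mulfK.
Qed.

(* Gibbs' inequality against the mixture of the uniform weight on words and of
   the weight proportional to wden^(-1/2): the latter dominates on bad words. *)
Lemma entropy_bad n :
  entropy nu (joint f (@quadrant R) n) <=
  ln 8 + n%:R * (ln 3 - gap * prb nu (bad n)).
Proof.
have mt := finvar_itint (n := n).
pose g (t : n.-tuple label) : {ffun 'I_n -> label} := [ffun i => tnth t i].
have -> : joint f (@quadrant R) n = g \o @itint R n.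
  by apply/funext => z; apply/ffunP => i; rewrite /g /= !ffunE tnth_mktuple ffunE.
apply: (le_trans (entropy_comp nu g mt)).
(* Each of the two weights has total mass at most 4 on admissible words, hence the division by 8. *)
pose q (t : n.-tuple label) : R := if sorted allowed t then
  ((3 ^+ n)^-1 + ((12 / 7) ^+ n)^-1 * (Num.sqrt (wden R t))^-1) / 8 else 0.
have c0 : 0 < (12 / 7 : R) by lra.
have p1 : 0 < (3 ^+ n)^-1 :> R by rewrite invr_gt0 exprn_gt0.
have p2 (t : seq label) : 0 < ((12 / 7) ^+ n)^-1 * (Num.sqrt (wden R t))^-1 :> R.
  by rewrite mulr_gt0// invr_gt0 ?exprn_gt0// sqrtr_gt0 wden_gt0.
have h := @gibbs _ _ _ nu _ (@itint R n) q mt.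
have sup t : 0 < law nu (@itint R n) t -> sorted allowed t.
  move=> l0; have [z <-] : exists z : circle R, itint n z = t.
    have [//|/forallNP ne] := pselect (exists z : circle R, itint n z = t).
    move: l0; rewrite /law.
    rewrite (_ : _ @^-1` _ = set0) ?prb0 ?ltxx//.
    by apply/seteqP; split => // z /ne.
  by rewrite val_itint; exact: sorted_itin.
apply: (le_trans (h _ _ _)) => {h}.
- move=> t; rewrite /q; case: ifP => // _; have := p2 t; lra.
- rewrite /q -big_mkcond /= -mulr_suml big_split /= -mulr_sumr ler_pdivrMr// mul1r.
  have h1 := @sum_sorted_invsqrt R n; have h2 := @sum_sorted_count R n.
  have h3 : \sum_(t : n.-tuple label | sorted allowed t) (3 ^+ n)^-1 <= 4 :> R.
    rewrite -[X in \sum_(t | _) X]mulr1 -mulr_sumr mulrC ler_pdivrMr ?exprn_gt0//.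
  have h4 : ((12 / 7) ^+ n)^-1 * \sum_(t : n.-tuple label | sorted allowed t)
      (Num.sqrt (wden R t))^-1 <= 4 :> R.
    by rewrite mulrC ler_pdivrMr ?exprn_gt0.
  by lra.
- by move=> t /sup st; rewrite /q st; have := p2 t; lra.
rewrite badE (prb_pred nu (fun t : n.-tuple label => wden R t < 3 ^+ n) mt).
have -> : ln 8 + n%:R * (ln 3 - gap * \sum_(t : n.-tuple label | wden R t < 3 ^+ n)
      law nu (@itint R n) t) =
    \sum_t law nu (@itint R n) t *
      (ln 8 + n%:R * ln 3 - (if wden R t < 3 ^+ n then n%:R * gap else 0)).
  under [in RHS]eq_bigr do rewrite mulrBr.
  rewrite sumrB -mulr_suml (sum_law nu mt) mul1r mulrBr addrA; congr (_ - _).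
  rewrite mulrA mulr_sumr big_mkcond /=; apply: eq_bigr => t _.
  by case: ifP => _; rewrite ?mulr0// mulrC.
apply: ler_sum => t _; have := law_ge0 nu (@itint R n) t.
rewrite le_eqVlt => /predU1P[<-|l0]; first by rewrite !mul0r oppr0.
rewrite -mulrN ler_wpM2l ?(ltW l0)// lerNl /q (sup _ l0).
have W0 := wden_gt0 R t.
(* On a bad word the second weight alone gives - ln q <= ln 8 + n ln (12/7) + (n/2) ln 3, which is
   ln 8 + n (ln 3 - gap); elsewhere the uniform weight gives ln 8 + n ln 3. *)
case: ifPn => [bt|_].
  have -> : - (ln 8 + n%:R * ln 3 - n%:R * gap) =
      ln (((12 / 7) ^+ n)^-1 * (Num.sqrt (3 ^+ n))^-1 / 8).
    have s0 : 0 < Num.sqrt (3 ^+ n : R) by rewrite sqrtr_gt0 exprn_gt0.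
    rewrite ln_div ?posrE ?mulr_gt0 ?invr_gt0 ?exprn_gt0//.
    rewrite lnM ?posrE ?invr_gt0 ?exprn_gt0// !lnV ?posrE ?exprn_gt0//.
    rewrite ln_sqrt ?exprn_gt0// !lnXn//.
    rewrite -[ln 3 *+ n]mulr_natr -[ln (12 / 7) *+ n]mulr_natr /gap.
    by move: (ln 8) (ln 3) (ln (12 / 7)) n%:R => a b c m; clear; lra.
  rewrite ler_ln ?posrE; first last.
  - by rewrite divr_gt0//; have := p2 t; lra.
  - by rewrite divr_gt0// mulr_gt0// ?invr_gt0 ?exprn_gt0// sqrtr_gt0 exprn_gt0.
  rewrite ler_pM2r ?invr_gt0//.
  apply: (@le_trans _ _ (((12 / 7) ^+ n)^-1 * (Num.sqrt (wden R t))^-1)); last by lra.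
  rewrite ler_pM2l ?invr_gt0 ?exprn_gt0// lef_pV2 ?posrE ?sqrtr_gt0 ?exprn_gt0//.
  by rewrite ler_sqrt ?exprn_gt0// ltW.
have -> : - (ln 8 + n%:R * ln 3 - 0) = ln ((3 ^+ n)^-1 / 8) :> R.
  rewrite ln_div ?posrE ?invr_gt0 ?exprn_gt0// lnV ?posrE ?exprn_gt0// lnXn//.
  by rewrite -[ln 3 *+ n]mulr_natr; move: (ln 8) (ln 3) n%:R => a b m; clear; lra.
rewrite ler_ln ?posrE ?divr_gt0//; have := p2 t; lra.
Qed.

End MaximalEntropy.

Lemma limn_esup_le (R : realType) (u : (\bar R)^nat) (N : nat) (b : \bar R) :
  (forall n, (N <= n)%N -> (u n <= b)%E) -> (limn_esup u <= b)%E.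
Proof.
move=> h; apply: (@le_trans _ _ (ereal_sup (u @` [set n | (N <= n)%N]))).
  by apply: ereal_inf_lbound; exists [set n | (N <= n)%N] => //; exists N.
by apply: ge_ereal_sup => _ [n /= Nn <-]; exact: h.
Qed.

Lemma exists_expr_lt (R : realType) (r c : R) : 0 < r -> r < 1 -> 0 < c ->
  exists N, forall n, (N <= n)%N -> r ^+ n < c.
Proof.
move=> r0 r1 c0.
have r1' : `|r| < 1 by rewrite gtr0_norm.
have /cvgrPdist_lt /(_ _ c0) [N _ hN] := cvg_expr r1'.
exists N => n Nn; have := hN n Nn; rewrite sub0r normrN => h.
exact: le_lt_trans (ler_norm _) h.
Qed.

(** * Almost every point is infinitely often good; the dimension bound *)

Section Dimension.
Variables (R : realType) (nu : probability (circle R) R).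
Hypothesis inv_nu : invariant_measure nu (@bowen_series R).
Hypothesis max_nu : ((ln 3)%:E <= measure_entropy nu (@bowen_series R))%E.

Lemma bad_frequently_small (eta : R) (N : nat) : 0 < eta ->
  exists2 n, (N <= n)%N & prb nu (@bad R n) <= eta.
Proof.
move=> eta0; apply: contrapT => nex.
have allbad n : (N <= n)%N -> eta < prb nu (@bad R n).
  by move=> Nn; rewrite ltNge; apply/negP => h; apply: nex; exists n.
have g0 := gap_gt0 R; have t0 : 0 < gap R * eta / 4 by rewrite divr_gt0 ?mulr_gt0.
(* The bad words lower the entropy rate by gap * eta. A quarter of this is spent on the tolerance in
   [join_entropy_le], and a quarter on absorbing ln 8 + M ln 3 once n exceeds P. *)
suff : (measure_entropy nu (@bowen_series R) <= (ln 3 - gap R * eta / 2)%:E)%E.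
  move=> h; have := le_trans max_nu h; rewrite lee_fin; lra.
apply: ge_ereal_sup => _ [k [xi [mxi ->]]].
have [M hM] := join_entropy_le (@measurable_bowen_series R) inv_nu
  (@finvar_quadrant R) (@quadrant_generates R nu inv_nu) mxi t0.
pose P := (Num.truncn ((ln 8 + M%:R * ln 3) / (gap R * eta / 4))).+1.
have hP : (ln 8 + M%:R * ln 3) / (gap R * eta / 4) < P%:R by exact: truncnS_gt.
apply: (@limn_esup_le _ _ (maxn N P).+1) => n Nn; rewrite lee_fin.
have n0 : 0 < n%:R :> R by rewrite ltr0n (leq_trans _ Nn).
have nN : (N <= n + M)%N.
  by rewrite (leq_trans (leq_maxl N P))// (leq_trans (ltnW Nn))// leq_addr.
have nP : P%:R <= n%:R :> R by rewrite ler_nat (leq_trans (leq_maxr N P))// ltnW.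
rewrite ler_pdivrMr//; apply: (le_trans (hM n)).
have h1 := entropy_bad inv_nu (n + M); have h2 := allbad _ nN.
have l3 : 0 < ln 3 :> R by rewrite ln_gt0// ltr1n.
have l8 : 0 <= ln 8 :> R by rewrite ln_ge0// ler1n.
move: hP; rewrite ltr_pdivrMr// => hP.
have h3 : ln 8 + M%:R * ln 3 <= n%:R * (gap R * eta / 4).
  by rewrite (le_trans (ltW hP))// ler_wpM2r// ltW.
have h4 : (n + M)%:R * (ln 3 - gap R * prb nu (@bad R (n + M))) <=
    (n + M)%:R * (ln 3 - gap R * eta).
  by rewrite ler_wpM2l// lerD2l lerN2 ler_wpM2l ?(ltW g0)// ltW.
have h5 : 0 <= M%:R * (gap R * eta) by rewrite mulr_ge0// mulr_ge0 ?ltW.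
move: h1 h4; rewrite natrD; move: (prb _ _) => p; clear -h3 h5; lra.
Qed.

Definition infinitely_often_good : set (circle R) := lim_sup_set (fun n => ~` @bad R n).

Lemma measurable_iog : measurable infinitely_often_good.
Proof.
apply: bigcapT_measurable => n; apply: bigcup_measurable => k _.
by apply: measurableC; exact: measurable_bad inv_nu _.
Qed.

(** Every tail union contains good sets of measure arbitrarily close to 1, so it has full measure,
    and so does the decreasing intersection. *)
Lemma iog_full : nu infinitely_often_good = 1%E.
Proof.
have mg k : measurable (~` @bad R k) by apply: measurableC; exact: measurable_bad inv_nu _.
have full n : nu (\bigcup_(k in [set k | (n <= k)%N]) ~` @bad R k) = 1%E.
  have mU : measurable (\bigcup_(k in [set k | (n <= k)%N]) ~` @bad R k).
    by apply: bigcup_measurable => k _; exact: mg.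
  apply/eqP; rewrite eq_le probability_le1//=.
  apply/lee_addgt0Pr => e e0.
  have [m nm hm] := @bad_frequently_small e n e0.
  rewrite -(prbE nu mU) -EFinD lee_fin.
  have : prb nu (~` @bad R m) <= prb nu (\bigcup_(k in [set k | (n <= k)%N]) ~` @bad R k).
    by apply: le_prb => // x bx; exists m.
  rewrite prb_setC; [lra|exact: measurable_bad inv_nu _].
have f0 : (nu (\bigcup_(k in [set k | (0 <= k)%N]) ~` @bad R k) < +oo)%E.
  by rewrite full ltry.
have h := @lim_sup_set_cvg _ _ _ nu _ mg f0.
have e1 : (fun n => nu (\bigcup_(k in [set k | (n <= k)%N]) ~` @bad R k)) = cst 1%E.
  by apply/funext => n; exact: full.
by move: h; rewrite e1 => h; apply: (cvg_unique _ h (cvg_cst _)).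
Qed.

(* Any number strictly between 12 / 7 and sqrt 3. *)
Let kappa : R := 43 / 25.
(** With this exponent s, D >= 3^n gives D^(-s) <= D^(-1/2) kappa^(-n). The gain kappa^(-n) beats
    the growth (12/7)^n of the sums of wden^(-1/2), and s < 1 because kappa^2 < 3. *)
Definition dim_bound : R := 1 / 2 + ln kappa / ln 3.

Lemma ln3_gt0 : 0 < ln 3 :> R. Proof. by rewrite ln_gt0// ltr1n. Qed.

Lemma dim_bound_gt0 : 0 < dim_bound.
Proof.
rewrite /dim_bound; have : 0 < ln kappa / ln 3.
  by rewrite divr_gt0 ?ln3_gt0// ln_gt0// /kappa; lra.
lra.
Qed.

Lemma dim_bound_lt1 : dim_bound < 1.
Proof.
have h : ln (kappa ^+ 2) < ln 3.
  have k0 : 0 < kappa by rewrite /kappa; lra.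
  by rewrite ltr_ln ?posrE ?exprn_gt0//; rewrite /kappa expr2; lra.
move: h; rewrite lnXn; last by rewrite /kappa; lra.
rewrite -[ln kappa *+ 2]mulr_natr => h; rewrite /dim_bound.
have : ln kappa / ln 3 < 1 / 2 by rewrite ltr_pdivrMr ?ln3_gt0//; lra.
lra.
Qed.

Lemma powR_dim_bound (D : R) (n : nat) : 0 < D -> 3 ^+ n <= D ->
  (18 / D) `^ dim_bound <= 18 * (Num.sqrt D)^-1 / kappa ^+ n.
Proof.
move=> D0 nD.
have k0 : 0 < kappa by rewrite /kappa; lra.
have s0 : 0 < Num.sqrt D by rewrite sqrtr_gt0.
rewrite -ler_ln ?posrE ?powR_gt0 ?divr_gt0 ?mulr_gt0 ?invr_gt0 ?exprn_gt0//.
rewrite ln_powR ln_div ?posrE// ln_div ?posrE ?mulr_gt0 ?invr_gt0 ?exprn_gt0//.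
rewrite lnM ?posrE ?invr_gt0// lnV ?posrE// ln_sqrt// lnXn// -[_ *+ n]mulr_natr.
have l8 : 0 <= ln 18 :> R by rewrite ln_ge0// ler1n.
have lD : n%:R * ln 3 <= ln D.
  by rewrite mulr_natl -lnXn// ler_ln ?posrE ?exprn_gt0.
have b1 := dim_bound_lt1.
have lk : 0 <= ln kappa by rewrite ln_ge0// /kappa; lra.
have h1 : dim_bound * ln 18 <= ln 18 by rewrite ler_piMl// ltW.
have h2 : ln D / 2 + ln kappa * n%:R <= dim_bound * ln D.
  rewrite /dim_bound mulrDl mul1r [_^-1 * _]mulrC lerD2l.
  have -> : ln kappa * n%:R = ln kappa / ln 3 * (n%:R * ln 3).
    by field; rewrite gt_eqF ?ln3_gt0.
  by rewrite ler_wpM2l// divr_ge0 ?(ltW ln3_gt0).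
by rewrite mulrBr; move: h1 h2; clear; lra.
Qed.

Definition good_word (N : nat) (w : seq label) : bool :=
  [&& (N < size w)%N, sorted allowed w & 3 ^+ size w <= wden R w].

(** For every N the cylinders of good words longer than N cover the set. Level n contributes at most
    18 * 4 * rho^n, the tail of a convergent geometric series. *)
Lemma hausdorff_measure_iog : hausdorff_measure dim_bound infinitely_often_good = 0%E.
Proof.
apply: (@hausdorff_measure_eq0 _ _ (seq label : countType)); first exact: dim_bound_gt0.
move=> delta e delta0 e0.
pose rho : R := 12 / 7 / kappa.
have rho0 : 0 < rho by rewrite /rho /kappa; lra.
have rho1 : rho < 1 by rewrite /rho /kappa; lra.
have k0 : 0 < kappa by rewrite /kappa; lra.
have c0 : 0 < e * (1 - rho) / 72 by rewrite divr_gt0 ?mulr_gt0 ?subr_gt0.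
have d0 : 0 < delta / 18 by rewrite divr_gt0.
(* [N1] makes the geometric tail 72 rho^N / (1 - rho) smaller than e, and [N2] makes the diameters,
   at most 18 / 3^n, smaller than delta. *)
have [N1 h1] := exists_expr_lt rho0 rho1 c0.
have [N2 h2] := @exists_expr_lt R 3^-1 _ ltac:(lra) ltac:(lra) d0.
pose N := maxn N1 N2.
pose a w : R := if good_word N w then 18 * (Num.sqrt (wden R w))^-1 / kappa ^+ size w else 0.
have a0 w : 0 <= a w.
  by rewrite /a; case: ifP => // _; rewrite divr_ge0 ?exprn_ge0 ?(ltW k0)// mulr_ge0//
    invr_ge0 sqrtr_ge0.
have dC w : good_word N w ->
    (diam [set z : circle R | itin (size w) z = w] <= (18 / wden R w)%:E)%E.
  move=> /and3P[Nw _ _]; apply: diam_le.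
    by rewrite divr_ge0 ?(ltW (wden_gt0 R w)).
  move=> x y /= ex ey; rewrite -{1}ex; apply: chord_wden; first exact: leq_trans Nw.
  by rewrite ex ey.
exists (fun w => if good_word N w then [set z | itin (size w) z = w] else set0), a; split.
- move=> z hz; have [n Nn gn] := hz N.+1 I; exists (itin n z) => //.
  rewrite /good_word size_map size_traject sorted_itin -[(N < n)%N]/(N.+1 <= n)%N Nn /=.
  by have -> : 3 ^+ n <= wden R (itin n z) by rewrite leNgt; apply/negP.
- move=> w; case: ifPn => [gw|_]; last by rewrite diam_set0 lee_fin ltW.
  apply: le_trans (dC _ gw) _; rewrite lee_fin.
  move: gw => /and3P[Nw _ gw]; have Nw2 : (N2 <= size w)%N.
    by rewrite (leq_trans (leq_maxr N1 N2))// ltnW.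
  have := h2 _ Nw2; rewrite ltr_pdivlMr// mulrC => /ltW; apply: le_trans.
  by rewrite ler_wpM2l// exprVn lef_pV2 ?posrE ?exprn_gt0// wden_gt0.
- move=> w; rewrite /a; case: ifPn => [gw|_]; last first.
    by rewrite diam_set0 poweR0r// gt_eqF// dim_bound_gt0.
  apply: (@le_trans _ _ ((18 / wden R w)%:E `^ dim_bound)%E).
    apply: gt0_ler_poweR; rewrite ?(ltW dim_bound_gt0)// ?in_itv /= ?leey ?andbT.
    + by rewrite /diam le_max lexx.
    + by rewrite lee_fin divr_ge0 ?(ltW (wden_gt0 R w)).
    + exact: dC.
  rewrite poweR_EFin lee_fin; apply: powR_dim_bound; first exact: wden_gt0.
  by case/and3P: gw.
- move=> l ul.
  have sb n : \sum_(t : n.-tuple label) a t <=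
      72 * (if (N <= n)%N then rho ^+ n else 0).
    have [Nn|nN] := leqP N n; last first.
      by rewrite mulr0 big1// => t _; rewrite /a /good_word size_tuple ltnNge (ltnW nN).
    apply: (@le_trans _ _ (\sum_(t : n.-tuple label | sorted allowed t)
        18 * (Num.sqrt (wden R t))^-1 / kappa ^+ n)).
      rewrite [leRHS]big_mkcond /=; apply: ler_sum => t _; rewrite /a /good_word size_tuple.
      case: sorted; last by rewrite andbF.
      case: ifP => // _.
      by rewrite divr_ge0 ?exprn_ge0 ?(ltW k0)// mulr_ge0// invr_ge0 sqrtr_ge0.
    rewrite -mulr_suml -mulr_sumr ler_pdivrMr ?exprn_gt0//.
    rewrite /rho expr_div_n -mulrA divfK ?gt_eqF ?exprn_gt0//.
    have := @sum_sorted_invsqrt R n; set S := \sum_(_ | _) _; move: S => S; lra.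
  have [M hM] := sum_uniq_words a0 sb ul; apply: (le_trans hM).
  rewrite -mulr_sumr; apply: (@le_trans _ _ (72 * (rho ^+ N / (1 - rho)))).
    by rewrite ler_wpM2l// sum_geometric_tail.
  have := h1 _ (leq_maxl N1 N2); rewrite -/N mulrA ler_pdivrMr ?subr_gt0//.
  by rewrite ltr_pdivlMr//; lra.
Qed.

End Dimension.

Theorem proposition6p22 (R : realType) (nu : probability (circle R) R) :
  maximal_entropy nu (@bowen_series R) -> (measure_dim nu < 1)%E.
Proof.
move=> [inv_nu max_nu].
have ge3 : ((ln 3)%:E <= measure_entropy nu (@bowen_series R))%E.
  by rewrite max_nu; exact: bowen_series_entropy_ge.
apply: (@le_lt_trans _ _ (dim_bound R)%:E); last first.
  by rewrite lte_fin dim_bound_lt1.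
apply: (@le_trans _ _ (hausdorff_dim (@infinitely_often_good R))).
  apply: ereal_inf_lbound; exists (@infinitely_often_good R) => //; split.
    exact: measurable_iog inv_nu.
  exact: iog_full inv_nu ge3.
apply: ereal_inf_lbound; exists (dim_bound R) => //; split.
  exact: dim_bound_gt0.
exact: hausdorff_measure_iog.
Qed.
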